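(* For all real $\alpha\ge0$ and all $t\in\mathbb{R}$, $$\left\|e^{-\mathrm{i}tH_\alpha}\right\|_{\ell^1(\sigma_\alpha)\to\ell^\infty(\sigma_\alpha^{-1})}=\left(\frac{1}{1+t^2}\right)^{\frac{1+\alpha}{2}}.$$
   Context: $\mathbb{N}_0=\{0,1,2,\dots\}$. For $\alpha>-1$, $H_\alpha$ is the (self-adjoint) operator in $\ell^2(\mathbb{N}_0)$ with maximal domain $\{u\in\ell^2(\mathbb{N}_0): \tau_\alpha u\in\ell^2(\mathbb{N}_0)\}$ acting by $H_\alpha u=\tau_\alpha u$, where $$(\tau_\alpha u)_n=\sqrt{n(n+\alpha)}\,u_{n-1}+(2n+1+\alpha)u_n+\sqrt{(n+1)(n+1+\alpha)}\,u_{n+1},\qquad u_{-1}:=0.$$ $e^{-\mathrm{i}tH_\alpha}$ is the associated unitary group on $\ell^2(\mathbb{N}_0)$. $\sigma_\alpha=\{\sigma_\alpha(n)\}_{n\ge0}$ with $\sigma_\alpha(n)=\binom{n+\alpha}{n}^{1/2}$, $\binom{n+\alpha}{n}=\frac{(\alpha+1)(\alpha+2)\cdots(\alpha+n)}{n!}$ (equal to $1$ for $n=0$), and $\sigma_\alpha^{-1}=\{1/\sigma_\alpha(n)\}_{n\ge 0}$. For a positive sequence $\sigma$, $\|u\|_{\ell^1(\sigma)}=\sum_{n\in\mathbb{N}_0}\sigma(n)|u(n)|$ and $\|u\|_{\ell^\infty(\sigma)}=\sup_{n\in\mathbb{N}_0}\sigma(n)|u(n)|$. For $\alpha\ge0$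 one has $\ell^1(\sigma_\alpha)\subset\ell^2(\mathbb{N}_0)$, and $\|\cdot\|_{\ell^1(\sigma_\alpha)\to\ell^\infty(\sigma_\alpha^{-1})}$ is the operator norm of the restriction to $\ell^1(\sigma_\alpha)$; it equals $\sup_{n,m\in\mathbb{N}_0}\frac{|\langle\delta_n,e^{-\mathrm{i}tH_\alpha}\delta_m\rangle|}{\sigma_\alpha(n)\sigma_\alpha(m)}$, where $(\delta_n)$ is the standard basis. *)

(* Defs.v *)
From Stdlib Require Import Reals Factorial.
From Coquelicot Require Import Coquelicot.
Open Scope R_scope.

Definition cseq := nat -> C.

(** * The Hilbert space l2(N_0) *)

Definition in_l2 (u : cseq) : Prop := ex_series (fun n => Cmod (u n) ^ 2).

Definition l2_norm (u : cseq) : R := sqrt (Series (fun n => Cmod (u n) ^ 2)).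

(** Operators on l2 are represented by total maps on sequences; only their
    action on l2 is constrained, the values outside l2 being irrelevant. *)
Record unitary (T : cseq -> cseq) : Prop := {
  unitary_l2 : forall u, in_l2 u -> in_l2 (T u);
  unitary_add : forall u v, in_l2 u -> in_l2 v ->
    T (fun n => (u n + v n)%C) = (fun n => (T u n + T v n)%C);
  unitary_scal : forall (c : C) u, in_l2 u ->
    T (fun n => (c * u n)%C) = (fun n => (c * T u n)%C);
  unitary_norm : forall u, in_l2 u -> l2_norm (T u) = l2_norm u;
  unitary_onto : forall v, in_l2 v -> exists u, in_l2 u /\ T u = v
}.

(** [is_unitary_group D A U]: [U t] is [exp (- i t A)] for the (unbounded)
    operator [A] with domain [D], in the sense of Stone's theorem: [U] is the
    strongly continuous one-parameter unitary group whose infinitesimal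
    generator is exactly [- i A], domain included.  When [A] is self-adjoint on
    [D], such a [U] exists and is unique on l2. *)
Record is_unitary_group (D : cseq -> Prop) (A : cseq -> cseq)
    (U : R -> cseq -> cseq) : Prop := {
  group_unitary : forall t, unitary (U t);
  group_zero : forall u, in_l2 u -> U 0 u = u;
  group_add : forall s t u, in_l2 u -> U (s + t) u = U s (U t u);
  group_continuous : forall u t, in_l2 u ->
    is_lim (fun s => l2_norm (fun n => (U s u n - U t u n)%C)) t 0;
  group_generator : forall u v, in_l2 u -> in_l2 v ->
    (D u /\ A u = v) <->
    is_lim (fun h => l2_norm (fun n =>
              ((U h u n - u n) / RtoC h - (- Ci * v n))%C)) 0 0
}.

(** * The operator H_alpha *)

Definition tau (alpha : R) (u : cseq) : cseq := fun n =>
  (RtoC (sqrt (INR n * (INR n + alpha)))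
     * match n with O => RtoC 0 | S k => u k end
   + RtoC (2 * INR n + 1 + alpha) * u n
   + RtoC (sqrt ((INR n + 1) * (INR n + 1 + alpha))) * u (S n))%C.

Definition H_dom (alpha : R) (u : cseq) : Prop :=
  in_l2 u /\ in_l2 (tau alpha u).

(** * Weighted spaces and operator norm *)

(** [(alpha + 1) (alpha + 2) ... (alpha + n)] *)
Fixpoint shifted_prod (alpha : R) (n : nat) : R :=
  match n with
  | O => 1
  | S k => shifted_prod alpha k * (alpha + INR (S k))
  end.

Definition sigma_seq (alpha : R) (n : nat) : R :=
  sqrt (shifted_prod alpha n / INR (fact n)).

Definition in_l1 (w : nat -> R) (u : cseq) : Prop :=
  ex_series (fun n => w n * Cmod (u n)).

Definition l1_norm (w : nat -> R) (u : cseq) : R :=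
  Series (fun n => w n * Cmod (u n)).

(** The value is [p_infty] when [u] does not belong to the weighted l-infinity
    space. *)
Definition linf_norm (w : nat -> R) (u : cseq) : Rbar :=
  Sup_seq (fun n => Finite (w n * Cmod (u n))).

(** Norm, as an operator from l1(w1) to l-infinity(w2), of the restriction of
    [T] to l1(w1); it is [p_infty] when that restriction is not bounded. *)
Definition l1_linf_opnorm (w1 w2 : nat -> R) (T : cseq -> cseq) : Rbar :=
  Glb_Rbar (fun c => 0 <= c /\
    forall u, in_l1 w1 u ->
      Rbar_le (linf_norm w2 (T u)) (Finite (c * l1_norm w1 u))).

(* Main.v *)
Require Import Defs.
From Stdlib Require Import Reals Lra Lia Factorial FunctionalExtensionality.
From Coquelicot Require Import Coquelicot.
Open Scope R_scope.

(** Let [a = i t / (1 + i t)], [b = 1 - 2 a] and [c = (1 + i t)^(-1-alpha)].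

    The vectors [sigma(n) z^n] are coherent states: the flow multiplies them by a scalar and
    moves [z] by the Moebius flow [z' = - i (1 + z)^2], so [exp(-itH) delta_0] is
    [c sigma(n) (-a)^n].  That the given group agrees with this explicit solution is a
    uniqueness statement of Carleman type: if [E_N] is the squared norm of the first [N + 1]
    components of a bounded solution vanishing at time [0], then
    [|E_N'| <= (N + 1 + alpha) (|y_N|^2 + |y_(N+1)|^2)], hence [sum_N E_N / (N + 1 + alpha)]
    is bounded, which forces [E_N = 0] because the harmonic series diverges.

    The other matrix elements follow from the first column since [exp(-itH)] commutes with [H];
    they are [c sigma(m) / sigma(n)] times the coefficient of [z^n] in
    [(b z - a)^m (1 + a z)^(-1-alpha-m)].  For [alpha = 0] this coefficient is the constant
    term in [w] of [P^n Q^m] with [P = -a + (1 - a) w] and [Q = -a + (1 - a) / w], because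
    [P Q = b - a P - a Q].  On the circle [|w|^2 = m / n] one has [n |P|^2 + m |Q|^2 = n + m],
    so [|P^n Q^m| <= 1] by the inequality of arithmetic and geometric means, and the
    coefficient has modulus at most [1].  Multiplying by [(1 + a z)^(-alpha)] then bounds it in
    general by [sum_(j <= n) (alpha)_j / j! = sigma(n)^2].  The entry at [(0, 0)] is [c], so
    the bound is attained. *)

(** * Finite sums of complex numbers *)

Definition csum (u : nat -> C) (N : nat) : C := sum_n u N.

Lemma csum_O (u : nat -> C) : csum u 0 = u 0%nat.
Proof. apply sum_O. Qed.

Lemma csum_S (u : nat -> C) (N : nat) : csum u (S N) = (csum u N + u (S N))%C.
Proof. apply (sum_Sn (G := C_AbelianMonoid)). Qed.

Lemma csum_ext (u v : nat -> C) (N : nat) :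
  (forall k, (k <= N)%nat -> u k = v k) -> csum u N = csum v N.
Proof. apply (sum_n_ext_loc (G := C_AbelianMonoid)). Qed.

Lemma csum_lin (p q : C) (u v : nat -> C) (N : nat) :
  csum (fun k => p * u k + q * v k)%C N = (p * csum u N + q * csum v N)%C.
Proof.
  induction N as [|N IH]; [now rewrite !csum_O|].
  rewrite !csum_S, IH; ring.
Qed.

Lemma csum_scal (p : C) (u : nat -> C) (N : nat) :
  csum (fun k => p * u k)%C N = (p * csum u N)%C.
Proof.
  induction N as [|N IH]; [now rewrite !csum_O|].
  rewrite !csum_S, IH; ring.
Qed.

Lemma csum_const (c : C) (N : nat) : csum (fun _ => c) N = (RtoC (INR (S N)) * c)%C.
Proof.
  induction N as [|N IH]; [rewrite csum_O; simpl; ring|].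
  rewrite csum_S, IH, (S_INR (S N)), RtoC_plus; ring.
Qed.

Lemma Cmod_csum (u : nat -> C) (v : nat -> R) (N : nat) :
  (forall k, (k <= N)%nat -> Cmod (u k) <= v k) -> Cmod (csum u N) <= sum_n v N.
Proof.
  induction N as [|N IH]; intros H; [rewrite csum_O, sum_O; auto|].
  rewrite csum_S, sum_Sn.
  eapply Rle_trans; [apply Cmod_triangle|].
  apply Rplus_le_compat; [apply IH; intros; apply H; lia | apply H; lia].
Qed.

(** * Averages over roots of unity *)

Definition expi (x : R) : C := (cos x, sin x).

Lemma expi_plus (x y : R) : expi (x + y) = (expi x * expi y)%C.
Proof. unfold expi, Cmult; simpl; rewrite cos_plus, sin_plus; f_equal; ring. Qed.

Lemma expi_0 : expi 0 = 1%C.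
Proof. unfold expi; now rewrite cos_0, sin_0. Qed.

Lemma expi_opp (x : R) : (expi (- x) * expi x)%C = 1%C.
Proof. rewrite <- expi_plus, Rplus_opp_l; apply expi_0. Qed.

Lemma expi_pow (x : R) (n : nat) : (expi x ^ n)%C = expi (INR n * x).
Proof.
  induction n as [|n IH]; [now rewrite Rmult_0_l, expi_0|].
  rewrite Cpow_S, IH, <- expi_plus, S_INR; f_equal; ring.
Qed.

Lemma expi_neq_1 (x : R) : 0 < x < 2 * PI -> expi x <> 1%C.
Proof.
  intros Hx H; injection H as Hc _.
  assert (Hs : 0 < sin (x / 2)) by (apply sin_gt_0; lra).
  replace x with (2 * (x / 2)) in Hc by field.
  rewrite cos_2a_sin in Hc; nra.
Qed.

Lemma geometric_csum (q : C) (N : nat) :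
  ((q - 1) * csum (fun k => q ^ k) N = q ^ S N - 1)%C.
Proof.
  induction N as [|N IH]; [rewrite csum_O; simpl; ring|].
  rewrite csum_S, Cmult_plus_distr_l, IH, !Cpow_S; ring.
Qed.

Section roots_of_unity.

Variables (N : nat) (w : nat -> C).
Hypothesis w_sum : forall j, (0 < j <= N)%nat -> csum (fun k => (w k ^ j)%C) N = 0%C.

(** Expanding the power leaves only exponents of [w k] between [j] and [j + n], all in the range
    where [w_sum] gives zero. Peeling off one factor lowers [n] by one and raises [j] by at most
    one. *)
Lemma root_average_monomial (p q : C) (n j : nat) :
  (0 < j)%nat -> (j + n <= N)%nat ->
  csum (fun k => (w k ^ j * (p + q * w k) ^ n)%C) N = 0%C.
Proof.
  revert j; induction n as [|n IH]; intros j Hj Hn.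
  - rewrite <- (w_sum j) by lia; apply csum_ext; intros; simpl; ring.
  - rewrite (csum_ext _ (fun k => (p * (w k ^ j * (p + q * w k) ^ n)
      + q * (w k ^ S j * (p + q * w k) ^ n))%C)).
    + rewrite csum_lin, !IH by lia; ring.
    + intros; rewrite !Cpow_S; ring.
Qed.

(** Averaging keeps only the constant term of the polynomial in [w k]. *)
Lemma root_average_pow (p q : C) (n : nat) :
  (n <= N)%nat ->
  csum (fun k => ((p + q * w k) ^ n)%C) N = (RtoC (INR (S N)) * p ^ n)%C.
Proof.
  induction n as [|n IH]; intros Hn; [exact (csum_const 1%C N)|].
  rewrite (csum_ext _ (fun k => (p * (p + q * w k) ^ n
      + q * (w k ^ 1 * (p + q * w k) ^ n))%C)).
  - rewrite csum_lin, IH, root_average_monomial, Cpow_S by lia; ring.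
  - intros; rewrite !Cpow_S; simpl; ring.
Qed.

End roots_of_unity.

(** The sign [s] treats the roots of unity of order [S N] and their inverses at once. For fixed [j]
    the summands form a geometric progression whose ratio is such a root, different from 1 because
    [0 < j < S N]. *)
Lemma expi_root_sum (N : nat) (s : R) (j : nat) :
  s = 1 \/ s = -1 -> (0 < j <= N)%nat ->
  csum (fun k => (expi (s * (2 * PI * INR k / INR (S N))) ^ j)%C) N = 0%C.
Proof.
  intros Hs Hj.
  assert (HN : 0 < INR (S N)) by (apply lt_0_INR; lia).
  set (x := s * (2 * PI * INR j / INR (S N))).
  assert (Hx : 0 < 2 * PI * INR j / INR (S N) < 2 * PI).
  { assert (0 < INR j) by (apply lt_0_INR; lia).
    assert (INR j < INR (S N)) by (apply lt_INR; lia).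
    pose proof PI_RGT_0.
    split; [apply Rdiv_lt_0_compat; nra|].
    apply Rlt_div_l; nra. }
  assert (Hne : expi x <> 1%C).
  { destruct Hs as [-> | ->]; unfold x.
    - rewrite Rmult_1_l; now apply expi_neq_1.
    - intros H; apply (expi_neq_1 _ Hx).
      rewrite <- (expi_opp (2 * PI * INR j / INR (S N))).
      replace (- (2 * PI * INR j / INR (S N))) with x by (unfold x; ring).
      rewrite (H : expi x = 1%C); ring. }
  rewrite (csum_ext _ (fun k => (expi x ^ k)%C)).
  - assert (H1 : (expi x ^ S N = 1)%C).
    { rewrite expi_pow; unfold x.
      (* The summand 0 gives the angle the shape required by [cos_period]. *)
      replace (INR (S N) * (s * (2 * PI * INR j / INR (S N))))
        with (s * (0 + 2 * INR j * PI)) by (field; lra).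
      unfold expi; destruct Hs as [-> | ->].
      - rewrite Rmult_1_l, cos_period, sin_period, cos_0, sin_0; reflexivity.
      - replace (-1 * (0 + 2 * INR j * PI)) with (- (0 + 2 * INR j * PI)) by ring.
        rewrite cos_neg, sin_neg, cos_period, sin_period, cos_0, sin_0, Ropp_0.
        reflexivity. }
    assert (Hg := geometric_csum (expi x) N).
    rewrite H1 in Hg.
    destruct (Ceq_dec (csum (fun k => (expi x ^ k)%C) N) 0) as [E|E]; [exact E|].
    exfalso; apply (Cmult_neq_0 (expi x - 1) (csum (fun k => (expi x ^ k)%C) N));
      [|exact E|rewrite Hg; ring].
    intros H; apply Hne.
    transitivity (expi x - 1 + 1)%C; [ring | rewrite H; ring].
  - intros k _; rewrite !expi_pow; f_equal; unfold x; field; lra.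
Qed.

(** * The recurrence *)

(** Coefficientwise form of [(1 + a z) x_(m+1) = (b z - a) x_m], [b = 1 - 2 a], where
    [x_m] is the power series with coefficients [x m]. *)
Definition mobius_rec (a : C) (x : nat -> nat -> C) : Prop := forall m,
  x (S m) 0%nat = (- a * x m 0%nat)%C /\
  forall n, x (S m) (S n) =
    (- a * x (S m) n + (1 - 2 * a) * x m n - a * x m (S n))%C.

(** [disc_coef a m n] is the coefficient of [z^n] in [(b z - a)^m / (1 + a z)^(m+1)]. *)
Fixpoint disc_coef (a : C) (m : nat) : nat -> C :=
  match m with
  | O => fun n => ((- a) ^ n)%C
  | S k => fix row (n : nat) : C :=
      match n with
      | O => (- a * disc_coef a k 0%nat)%C
      | S l => (- a * row l + (1 - 2 * a) * disc_coef a k l - a * disc_coef a k (S l))%C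
      end
  end.

Lemma disc_coef_rec (a : C) : mobius_rec a (disc_coef a).
Proof. intros m; split; reflexivity. Qed.

Lemma disc_coef_0_r (a : C) (m : nat) : disc_coef a m 0 = ((- a) ^ m)%C.
Proof. induction m as [|m IH]; [reflexivity|]. simpl; now rewrite IH. Qed.

(** The average extracts the constant term of a Laurent polynomial, which does not change when the
    circle is rescaled; hence [r] is free and can be optimised later. For [m = 0] or [n = 0] only
    one factor remains and [root_average_pow] applies. *)
Lemma disc_coef_average (a : C) (N : nat) (w w' : nat -> C) (r : C) (m n : nat) :
  r <> 0%C ->
  (forall k, (w k * w' k = 1)%C) ->
  (forall j, (0 < j <= N)%nat -> csum (fun k => (w k ^ j)%C) N = 0%C) ->
  (forall j, (0 < j <= N)%nat -> csum (fun k => (w' k ^ j)%C) N = 0%C) ->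
  (m <= N)%nat -> (n <= N)%nat ->
  csum (fun k => ((- a + (1 - a) * r * w k) ^ n * (- a + (1 - a) / r * w' k) ^ m)%C) N
  = (RtoC (INR (S N)) * disc_coef a m n)%C.
Proof.
  intros Hr Hww Hw Hw'; revert n.
  induction m as [|m IHm]; intros n Hm Hn.
  - change (disc_coef a 0 n) with ((- a) ^ n)%C.
    rewrite <- (root_average_pow N w Hw (- a)%C ((1 - a) * r)%C) by lia.
    apply csum_ext; intros; simpl; ring.
  - induction n as [|n IHn].
    + rewrite disc_coef_0_r, <- (root_average_pow N w' Hw' (- a)%C ((1 - a) / r)%C) by lia.
      apply csum_ext; intros; simpl; ring.
    + rewrite (csum_ext _ (fun k =>
        (- a * ((- a + (1 - a) * r * w k) ^ n * (- a + (1 - a) / r * w' k) ^ S m)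
         + 1 * ((1 - 2 * a) * ((- a + (1 - a) * r * w k) ^ n * (- a + (1 - a) / r * w' k) ^ m)
         + - a * ((- a + (1 - a) * r * w k) ^ S n * (- a + (1 - a) / r * w' k) ^ m)))%C)).
      * rewrite !csum_lin, IHn, !IHm by lia. simpl; ring.
      * intros k _; rewrite !Cpow_S.
        set (P := (- a + (1 - a) * r * w k)%C); set (Q := (- a + (1 - a) / r * w' k)%C).
        (* Hence every average of [P^n Q^m] obeys the same recurrence as [disc_coef]. *)
        assert (HPQ : (P * Q = 1 - 2 * a - a * P - a * Q)%C).
        { unfold P, Q. transitivity
            (a * a - a * (1 - a) * (r * w k + w' k / r) + (1 - a) ^ 2 * (w k * w' k))%C;
            [field; exact Hr|].
          rewrite Hww; field; exact Hr. }
        transitivity (P ^ n * Q ^ m * (P * Q))%C; [ring|].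
        rewrite HPQ; ring.
Qed.

(** Weighted inequality of arithmetic and geometric means, from [x <= exp (x - 1)]: by the
    hypothesis the exponents add up to 0. *)
Lemma pow_mult_le_1 (A B : R) (n m : nat) :
  0 <= A -> 0 <= B -> INR n * A + INR m * B = INR n + INR m -> A ^ n * B ^ m <= 1.
Proof.
  assert (Hexp : forall x k, 0 <= x -> x ^ k <= exp (INR k * (x - 1))).
  { intros x k Hx; induction k as [|k IH]; [rewrite Rmult_0_l, exp_0; simpl; lra|].
    rewrite S_INR, Rmult_plus_distr_r, Rmult_1_l, exp_plus, Rmult_comm; simpl.
    pose proof (exp_ineq1_le (x - 1)); pose proof (pow_le x k Hx).
    rewrite (Rmult_comm x).
    rewrite (Rmult_comm (exp (x - 1))); apply Rmult_le_compat; lra. }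
  intros HA HB H.
  apply Rle_trans with (exp (INR n * (A - 1)) * exp (INR m * (B - 1))).
  - apply Rmult_le_compat; auto using pow_le.
  - rewrite <- exp_plus.
    replace (INR n * (A - 1) + INR m * (B - 1)) with 0 by lra.
    rewrite exp_0; lra.
Qed.

(** The hypothesis puts [a] on the circle with diameter [0, 1], that is, |a|^2 + |1 - a|^2 = 1.
    There every term of the average has modulus at most 1. The cases [m = 0] and [n = 0] are
    separate because the radius below degenerates. *)
Lemma Cmod_disc_coef_le_1 (a : C) (m n : nat) :
  Re a = Re a ^ 2 + Im a ^ 2 -> Cmod (disc_coef a m n) <= 1.
Proof.
  intros Ha.
  assert (Ha1 : Cmod (- a) <= 1).
  { rewrite Cmod_opp. assert (Cmod a ^ 2 <= 1) by (rewrite Cmod2_alt; nra).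
    pose proof (Cmod_ge_0 a); nra. }
  assert (Hpow : forall k, Cmod ((- a) ^ k) <= 1).
  { intros k; rewrite Cmod_pow, <- (pow1 k); apply pow_incr.
    split; [apply Cmod_ge_0 | exact Ha1]. }
  destruct (Nat.eq_dec m 0) as [->|Hm]; [apply Hpow|].
  destruct (Nat.eq_dec n 0) as [->|Hn]; [rewrite disc_coef_0_r; apply Hpow|].
  assert (Hm' : 0 < INR m) by (apply lt_0_INR; lia).
  assert (Hn' : 0 < INR n) by (apply lt_0_INR; lia).
  (* This radius cancels the terms in [sin] of [n |P|^2 + m |Q|^2] below. *)
  set (r := sqrt (INR m / INR n)).
  assert (Hr : 0 < r) by (apply sqrt_lt_R0, Rdiv_lt_0_compat; lra).
  assert (Hr2 : r * r = INR m / INR n) by (apply sqrt_sqrt, Rlt_le, Rdiv_lt_0_compat; lra).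
  (* Any [N] not below [m] and [n] serves: the exponents from [-m] to [n] then contain no nonzero
     multiple of [S N]. *)
  set (N := (m + n)%nat).
  set (th := fun k => 2 * PI * INR k / INR (S N)).
  assert (Hav := disc_coef_average a N (fun k => expi (1 * th k)) (fun k => expi (-1 * th k))
    (RtoC r) m n).
  assert (HN : 0 < INR (S N)) by (apply lt_0_INR; lia).
  assert (Hs : Cmod (RtoC (INR (S N)) * disc_coef a m n) <= INR (S N) * 1).
  { rewrite <- Hav; clear Hav.
    - rewrite <- sum_n_const; apply Cmod_csum; intros k _.
      rewrite Rmult_1_l; replace (-1 * th k) with (- th k) by ring.
      set (P := (- a + _ * expi (th k))%C); set (Q := (- a + _ * expi (- th k))%C).
      rewrite Cmod_mult, !Cmod_pow.
      (* The mean inequality is applied to squared moduli, which are polynomial in the coordinates.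
         The bound on the moduli follows at the end, for a nonnegative number whose square is at
         most 1. *)
      assert (H : (Cmod P ^ 2) ^ n * (Cmod Q ^ 2) ^ m <= 1).
      { apply pow_mult_le_1; try apply pow2_ge_0.
        rewrite !Cmod2_alt; unfold P, Q.
        replace (RtoC r) with ((r, 0) : C) by reflexivity.
        replace ((1 - a) / (r, 0))%C with ((1 - a) * RtoC (/ r))%C
          by (unfold Cdiv; f_equal; rewrite RtoC_inv by lra; reflexivity).
        destruct a as [x y]; unfold expi; simpl in Ha |- *.
        rewrite cos_neg, sin_neg.
        pose proof (sin2_cos2 (th k)) as Hsc; unfold Rsqr in Hsc.
        set (c := cos (th k)) in *; set (s := sin (th k)) in *.
        assert (Hm2 : INR m = INR n * (r * r)) by (rewrite Hr2; field; lra).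
        assert (Hy : y * y = x - x * x) by (simpl in Ha; lra).
        (* [HP] at [z = r] gives |P|^2 and [HQ] at [z = / r] gives |Q|^2; the cosine terms vanish
           since [x^2 + y^2 = x]. In the weighted sum, [m = n r^2] cancels the sine terms and leaves
           [n + m]. *)
        assert (HP : forall z, (- x + ((1 - x) * c + y * s) * z) ^ 2
            + (- y + ((1 - x) * s - y * c) * z) ^ 2
            = x + (1 - x) * (z * z) - 2 * z * y * s).
        { intros z.
          transitivity (x * x + y * y + ((1 - x) * (1 - x) + y * y) * (s * s + c * c) * (z * z)
            - 2 * z * (y * s + c * (x - x * x - y * y))); [ring|].
          rewrite Hsc, Hy; ring. }
        assert (HQ : forall z, (- x + ((1 - x) * c - y * s) * z) ^ 2
            + (- y - ((1 - x) * s + y * c) * z) ^ 2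
            = x + (1 - x) * (z * z) + 2 * z * y * s).
        { intros z.
          transitivity (x * x + y * y + ((1 - x) * (1 - x) + y * y) * (s * s + c * c) * (z * z)
            - 2 * z * (- y * s + c * (x - x * x - y * y))); [ring|].
          rewrite Hsc, Hy; ring. }
        match goal with |- INR n * ?A + INR m * ?B = _ =>
          replace A with (x + (1 - x) * (r * r) - 2 * r * y * s)
            by (rewrite <- HP; ring);
          replace B with (x + (1 - x) * (/ r * / r) + 2 * / r * y * s)
            by (rewrite <- HQ; ring)
        end.
        rewrite Hm2; field; lra. }
      assert (HP := Cmod_ge_0 P); assert (HQ := Cmod_ge_0 Q).
      rewrite <- !pow_mult, (Nat.mul_comm 2 n), (Nat.mul_comm 2 m), !pow_mult in H.
      rewrite <- Rpow_mult_distr in H.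
      pose proof (pow_le _ n HP); pose proof (pow_le _ m HQ).
      assert (0 <= Cmod P ^ n * Cmod Q ^ m) by now apply Rmult_le_pos.
      nra.
    - intros H; injection H; lra.
    - intros k; rewrite <- expi_plus, <- expi_0; f_equal; ring.
    - intros j Hj; apply expi_root_sum; auto.
    - intros j Hj; apply expi_root_sum; auto.
    - unfold N; lia.
    - unfold N; lia. }
  rewrite Cmod_mult, Cmod_R, Rabs_right in Hs by lra.
  now apply Rmult_le_reg_l in Hs.
Qed.

(** * Generalised binomial coefficients *)

Definition binom (alpha : R) (n : nat) : R := shifted_prod alpha n / INR (fact n).

Lemma INR_fact_pos (n : nat) : 0 < INR (fact n).
Proof. apply lt_0_INR, lt_O_fact. Qed.

Lemma binom_S (alpha : R) (n : nat) :
  (INR n + 1) * binom alpha (S n) = (INR n + 1 + alpha) * binom alpha n.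
Proof.
  unfold binom; change (fact (S n)) with (S n * fact n)%nat.
  change (shifted_prod alpha (S n)) with (shifted_prod alpha n * (alpha + INR (S n))).
  rewrite mult_INR, S_INR.
  pose proof (INR_fact_pos n); pose proof (pos_INR n).
  field; lra.
Qed.

Lemma binom_0 (alpha : R) : binom alpha 0 = 1.
Proof. unfold binom; simpl; field. Qed.

Lemma binom_pos (alpha : R) (n : nat) : -1 < alpha -> 0 < binom alpha n.
Proof.
  intros H; induction n as [|n IH]; [rewrite binom_0; lra|].
  pose proof (binom_S alpha n); pose proof (pos_INR n).
  apply (Rmult_lt_reg_l (INR n + 1)); [lra|].
  rewrite H0, Rmult_0_r; apply Rmult_lt_0_compat; lra.
Qed.

Lemma binom_pred_S (alpha : R) (n : nat) :
  (INR n + 1) * binom (alpha - 1) (S n) = alpha * binom alpha n.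
Proof.
  assert (H : forall k, shifted_prod (alpha - 1) (S k) = alpha * shifted_prod alpha k).
  { induction k as [|k IH]; [simpl; ring|].
    change (shifted_prod (alpha - 1) (S (S k)))
      with (shifted_prod (alpha - 1) (S k) * (alpha - 1 + INR (S (S k)))).
    change (shifted_prod alpha (S k)) with (shifted_prod alpha k * (alpha + INR (S k))).
    rewrite IH, !S_INR; ring. }
  unfold binom; rewrite H; change (fact (S n)) with (S n * fact n)%nat.
  rewrite mult_INR, S_INR; pose proof (INR_fact_pos n); pose proof (pos_INR n).
  field; lra.
Qed.

Lemma binom_pred_nonneg (alpha : R) (n : nat) : 0 <= alpha -> 0 <= binom (alpha - 1) n.
Proof.
  intros H; destruct n as [|n]; [rewrite binom_0; lra|].
  pose proof (binom_pred_S alpha n); pose proof (pos_INR n).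
  pose proof (binom_pos alpha n ltac:(lra)).
  apply (Rmult_le_reg_l (INR n + 1)); [lra|].
  rewrite H0, Rmult_0_r; apply Rmult_le_pos; lra.
Qed.

(** Coefficientwise form of (1 - z)^(-alpha) / (1 - z) = (1 - z)^(-1-alpha). *)
Lemma sum_binom_pred (alpha : R) (n : nat) :
  sum_n (binom (alpha - 1)) n = binom alpha n.
Proof.
  induction n as [|n IH]; [rewrite sum_O, !binom_0; reflexivity|].
  rewrite sum_Sn, IH; unfold plus; simpl.
  pose proof (binom_pred_S alpha n); pose proof (binom_S alpha n).
  pose proof (pos_INR n); nra.
Qed.

(** * Cauchy products and the kernel for general [alpha] *)

Definition conv (g : nat -> C) (x : nat -> nat -> C) (m n : nat) : C :=
  csum (fun j => g j * x m (n - j)%nat)%C n.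

(** Multiplication by a power series that does not depend on [m] commutes with the multiplications
    by [1 + a z] and [b z - a] encoded in the recurrence. *)
Lemma conv_mobius_rec (a : C) (g : nat -> C) (x : nat -> nat -> C) :
  mobius_rec a x -> mobius_rec a (conv g x).
Proof.
  intros Hx m; destruct (Hx m) as [H0 HS]; unfold conv; split.
  - rewrite !csum_O; simpl Nat.sub; rewrite H0; ring.
  - intros n.
    (* The term [j = n + 1] meets the second index 0, where the other clause of the recurrence
       applies, so it is split off. *)
    rewrite (csum_S _ n), (csum_S (fun j => g j * x m (S n - j)%nat)%C n).
    cbv beta; rewrite !Nat.sub_diag, H0.
    rewrite (csum_ext _ (fun j => - a * (g j * x (S m) (n - j)%nat)
      + 1 * ((1 - 2 * a) * (g j * x m (n - j)%nat)
      + - a * (g j * x m (S n - j)%nat)))%C).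
    + rewrite !csum_lin; ring.
    + intros j Hj; replace (S n - j)%nat with (S (n - j)) by lia.
      rewrite HS; ring.
Qed.

(** Taylor coefficients, in the second index, of
    [(b z - a)^m (1 + a z)^(-1-alpha-m)] with [b = 1 - 2 a]. *)
Definition kern (alpha : R) (a : C) : nat -> nat -> C :=
  conv (fun j => (RtoC (binom (alpha - 1) j) * (- a) ^ j)%C) (disc_coef a).

Lemma kern_0_l (alpha : R) (a : C) (n : nat) :
  kern alpha a 0 n = (RtoC (binom alpha n) * (- a) ^ n)%C.
Proof.
  rewrite <- sum_binom_pred; unfold kern, conv.
  transitivity ((- a) ^ n * csum (fun j => RtoC (binom (alpha - 1) j)) n)%C.
  - rewrite <- csum_scal; apply csum_ext; intros j Hj; simpl disc_coef.
    replace n with (j + (n - j))%nat at 2 by lia; rewrite Cpow_add_r; ring.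
  - rewrite Cmult_comm; f_equal.
    induction n as [|n IH]; [now rewrite csum_O, sum_O|].
    rewrite csum_S, sum_Sn, IH, <- RtoC_plus; reflexivity.
Qed.

(** For [alpha >= 0] the coefficients of (1 - z)^(-alpha) are nonnegative, so bounding the other
    factors by 1 in each term leaves exactly the sum in [sum_binom_pred]. *)
Lemma Cmod_kern_le (alpha : R) (a : C) (m n : nat) :
  0 <= alpha -> Re a = Re a ^ 2 + Im a ^ 2 -> Cmod (kern alpha a m n) <= binom alpha n.
Proof.
  intros Hal Ha; rewrite <- sum_binom_pred; apply Cmod_csum; intros j _.
  rewrite !Cmod_mult, Cmod_R, Rabs_right
    by (apply Rle_ge, binom_pred_nonneg, Hal).
  assert (H1 := Cmod_disc_coef_le_1 a 0 j Ha); simpl disc_coef in H1.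
  assert (H2 := Cmod_disc_coef_le_1 a m (n - j) Ha).
  pose proof (binom_pred_nonneg alpha j Hal).
  pose proof (Cmod_ge_0 ((- a) ^ j)); pose proof (Cmod_ge_0 (disc_coef a m (n - j))).
  assert (Cmod ((- a) ^ j) * Cmod (disc_coef a m (n - j)) <= 1 * 1)
    by (apply Rmult_le_compat; assumption).
  rewrite Rmult_assoc; nra.
Qed.

(** * The contiguity relation between neighbouring columns *)

Definition upper (x : nat -> C) (n : nat) : C :=
  match n with O => RtoC 0 | S k => x k end.

(** The identity [H U delta_m = U H delta_m] in terms of
    [x m n = sigma(n) <delta_n, U delta_m> / sigma(m)]. *)
Definition contiguous (alpha : R) (x : nat -> nat -> C) (m : nat) : Prop :=
  forall n,
  ((RtoC (INR n) + RtoC alpha) * upper (x m) n + 2 * RtoC (INR n) * x m n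
    + (RtoC (INR n) + 1) * x m (S n)
   = RtoC (INR m) * match m with O => RtoC 0 | S k => x k n end + 2 * RtoC (INR m) * x m n
    + (RtoC (INR m) + 1 + RtoC alpha) * x (S m) n)%C.

Lemma Ceq_of_zero (p l r : C) : p = 0%C -> (l - r)%C = p -> l = r.
Proof. intros -> H; transitivity (l - r + r)%C; [ring | rewrite H; ring]. Qed.

Lemma Czero_add (p q : C) : p = 0%C -> q = 0%C -> (p + q)%C = 0%C.
Proof. intros -> ->; ring. Qed.

Lemma Czero_scal (c l r : C) : l = r -> (c * (l - r))%C = 0%C.
Proof. intros ->; ring. Qed.

(* [Ceq_of_zero _ _ _ (c1 · E1 ⊕ c2 · E2)] reduces a goal to the [ring] identity
   saying that it is the linear combination of the equations [E1] and [E2]. *)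
Local Notation "c '·' E" := (Czero_scal c%C _ _ E) (at level 40).
Local Notation "E ⊕ F" := (Czero_add _ _ E F) (at level 50, left associativity).

(** In terms of the power series F_m with coefficients [x m], the left side is (1 + z)^2 F_m' + (1 +
    alpha) z F_m. The proof stays with coefficients: row 0 is explicit, and the relation at
    [(m + 1, n + 1)] is a linear combination of those at [(m + 1, n)], [(m, n)], [(m, n + 1)] and of
    instances of the recurrence. *)
Lemma mobius_rec_contiguous (alpha : R) (a : C) (x : nat -> nat -> C) :
  mobius_rec a x ->
  (forall n, x 0%nat n = RtoC (binom alpha n) * (- a) ^ n)%C ->
  forall m, contiguous alpha x m.
Proof.
  intros Hx Hx0.
  assert (Hb : forall n, ((RtoC (INR n) + 1) * RtoC (binom alpha (S n))
      = (RtoC (INR n) + 1 + RtoC alpha) * RtoC (binom alpha n))%C).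
  { intros n; rewrite <- !RtoC_plus, <- !RtoC_mult, binom_S; reflexivity. }
  assert (H0 : contiguous alpha x 0).
  { intros n; induction n as [|n IH].
    - destruct (Hx 0%nat) as [H _]; rewrite H; simpl upper; rewrite !Hx0.
      pose proof (Hb 0%nat) as Hb0; rewrite binom_0 in *; simpl INR in *.
      apply (Ceq_of_zero _ _ _ ((- a) · Hb0)); simpl; ring.
    - destruct (Hx 0%nat) as [_ H]; rewrite H; clear H.
      assert (Hy : forall k, ((RtoC (INR k) + 1) * x 0%nat (S k)
          = (RtoC (INR k) + 1 + RtoC alpha) * (- a) * x 0%nat k)%C).
      { intros k; rewrite !Hx0, Cpow_S.
        apply (Ceq_of_zero _ _ _ ((- a * (- a) ^ k) · Hb k)); ring. }
      (* This is [Hy] one index lower; at [n = 0] both sides vanish, so the default value of [upper]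
         does no harm. *)
      assert (Hu : (- a * ((RtoC (INR n) + RtoC alpha) * upper (x 0%nat) n)
          = RtoC (INR n) * x 0%nat n)%C).
      { destruct n as [|n]; [simpl; ring|].
        assert (H := Hy n); rewrite S_INR, RtoC_plus; simpl upper.
        symmetry; apply (Ceq_of_zero _ _ _ (1 · H)); ring. }
      assert (H1 := Hy n); assert (H2 := Hy (S n)).
      rewrite S_INR, RtoC_plus in H2 |- *; simpl upper; simpl INR in *.
      apply (Ceq_of_zero _ _ _ ((- a) · IH ⊕ 2 · H1 ⊕ 1 · H2 ⊕ (- (1)) · Hu)); ring. }
  induction m as [|m IHm]; [exact H0|].
  set (M := RtoC (INR m)).
  assert (HM : RtoC (INR (S m)) = (M + 1)%C) by (rewrite S_INR, RtoC_plus; reflexivity).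
  intros n; induction n as [|n IHn].
  - destruct (Hx m) as [E1 E2]; destruct (Hx (S m)) as [E3 _].
    specialize (E2 0%nat); assert (E4 := IHm 0%nat).
    assert (E5 : (- a * (M * match m with O => RtoC 0 | S k => x k 0%nat end)
        = M * x m 0%nat)%C).
    { unfold M; destruct m as [|k]; [simpl; ring|].
      destruct (Hx k) as [E _]; rewrite E; ring. }
    rewrite HM; fold M in E4; simpl upper in *; simpl INR in *.
    rewrite E2, E3, E1 in *.
    apply (Ceq_of_zero _ _ _ ((- a) · E4 ⊕ 1 · E5)); ring.
  - destruct (Hx m) as [E0 E1]; destruct (Hx (S m)) as [_ E4].
    assert (E2 := E1 n); specialize (E1 (S n)); specialize (E4 n).
    (* With the default 0 in [upper], both clauses of the recurrence take a single form valid for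
       every [n]. *)
    assert (E3 : (x (S m) n = - a * upper (x (S m)) n + (1 - 2 * a) * upper (x m) n
        - a * x m n)%C).
    { destruct n as [|n]; [simpl; rewrite E0; ring | apply Hx]. }
    assert (E5 : (M * x m (S n) = M * (- a * x m n
        + (1 - 2 * a) * match m with O => RtoC 0 | S k => x k n end
        - a * match m with O => RtoC 0 | S k => x k (S n) end))%C).
    { unfold M; destruct m as [|k]; [simpl; ring|]. f_equal; apply Hx. }
    assert (F1 := IHm n); assert (F2 := IHm (S n)); fold M in F1, F2.
    set (N := RtoC (INR n)) in *.
    assert (HN : RtoC (INR (S n)) = (N + 1)%C) by (rewrite S_INR, RtoC_plus; reflexivity).
    rewrite HN, HM in *; simpl upper in *.
    apply (Ceq_of_zero _ _ _ ((- a) · IHn ⊕ (1 - 2 * a) · F1 ⊕ (- a) · F2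
      ⊕ (N + 2) · E1 ⊕ (2 * (N + 1) - 2 * (M + 1)) · E2 ⊕ (N + RtoC alpha) · E3
      ⊕ (- (M + 2 + RtoC alpha)) · E4 ⊕ (- (1)) · E5)).
    ring.
Qed.

(** * Partial sums and the space l2 *)

Lemma sum_n_le_Series (a : nat -> R) (N : nat) :
  (forall n, 0 <= a n) -> ex_series a -> sum_n a N <= Series a.
Proof.
  intros Ha Hex.
  apply (is_lim_seq_incr_compare (sum_n a) (Series a)).
  - apply Series_correct, Hex.
  - intros n; rewrite sum_Sn; unfold plus; simpl; specialize (Ha (S n)); lra.
Qed.

Lemma sum_n_mono (a : nat -> R) (n N : nat) :
  (forall n, 0 <= a n) -> (n <= N)%nat -> sum_n a n <= sum_n a N.
Proof.
  intros Ha Hn; induction Hn as [|N Hn IH]; [lra|].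
  rewrite sum_Sn; unfold plus; simpl; specialize (Ha (S N)); lra.
Qed.

Lemma term_le_sum_n (a : nat -> R) (n N : nat) :
  (forall n, 0 <= a n) -> (n <= N)%nat -> a n <= sum_n a N.
Proof.
  intros Ha Hn; eapply Rle_trans; [|now apply sum_n_mono, Hn].
  destruct n as [|n]; [rewrite sum_O; lra|].
  rewrite sum_Sn; unfold plus; simpl.
  assert (H := sum_n_mono a 0 n Ha ltac:(lia)); rewrite sum_O in H.
  specialize (Ha 0%nat); lra.
Qed.

Lemma Cmod2_plus_le (x y : C) : Cmod (x + y) ^ 2 <= 2 * Cmod x ^ 2 + 2 * Cmod y ^ 2.
Proof.
  pose proof (Cmod_triangle x y); pose proof (Cmod_ge_0 (x + y)).
  pose proof (pow2_ge_0 (Cmod x - Cmod y)); nra.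
Qed.

Lemma in_l2_lin (p q : C) (u v : cseq) :
  in_l2 u -> in_l2 v -> in_l2 (fun n => p * u n + q * v n)%C.
Proof.
  intros Hu Hv.
  apply (ex_series_le (V := R_CompleteNormedModule) _
    (fun n => 2 * Cmod p ^ 2 * Cmod (u n) ^ 2 + 2 * Cmod q ^ 2 * Cmod (v n) ^ 2)).
  - intros n; unfold norm; simpl; unfold abs; simpl.
    rewrite Rabs_right by (apply Rle_ge, pow2_ge_0).
    eapply Rle_trans; [apply Cmod2_plus_le|].
    rewrite !Cmod_mult, !Rpow_mult_distr; lra.
  - apply (ex_series_plus (V := R_NormedModule)).
    + now apply (ex_series_scal (V := R_NormedModule) (2 * Cmod p ^ 2) (fun n => Cmod (u n) ^ 2)).
    + now apply (ex_series_scal (V := R_NormedModule) (2 * Cmod q ^ 2) (fun n => Cmod (v n) ^ 2)).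
Qed.

Lemma in_l2_ext (u v : cseq) : (forall n, u n = v n) -> in_l2 u -> in_l2 v.
Proof. intros H; now replace v with u by (apply functional_extensionality, H). Qed.

Lemma Cmod_le_l2_norm (u : cseq) (n : nat) : in_l2 u -> Cmod (u n) <= l2_norm u.
Proof.
  intros Hu; unfold l2_norm.
  rewrite <- (sqrt_pow2 (Cmod (u n))) by apply Cmod_ge_0.
  apply sqrt_le_1_alt.
  eapply Rle_trans; [|apply (sum_n_le_Series _ n); [intros; apply pow2_ge_0 | exact Hu]].
  apply (term_le_sum_n (fun n => Cmod (u n) ^ 2)); [intros; apply pow2_ge_0 | lia].
Qed.

Lemma sum_Cmod2_le_l2_norm (u : cseq) (N : nat) :
  in_l2 u -> sum_n (fun n => Cmod (u n) ^ 2) N <= l2_norm u ^ 2.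
Proof.
  intros Hu; unfold l2_norm.
  assert (H : forall M, sum_n (fun n => Cmod (u n) ^ 2) M <= Series (fun n => Cmod (u n) ^ 2)).
  { intros M; apply sum_n_le_Series; [intros; apply pow2_ge_0 | exact Hu]. }
  rewrite pow2_sqrt; [apply H|].
  apply Rle_trans with (2 := H 0%nat); rewrite sum_O; apply pow2_ge_0.
Qed.

Lemma unitary_lin (T : cseq -> cseq) (p q : C) (u v : cseq) :
  unitary T -> in_l2 u -> in_l2 v ->
  T (fun n => p * u n + q * v n)%C = (fun n => p * T u n + q * T v n)%C.
Proof.
  intros HT Hu Hv.
  assert (Hs : forall c w, in_l2 w -> in_l2 (fun n => c * w n)%C).
  { intros c w Hw; apply in_l2_ext with (fun n => c * w n + 0 * w n)%C.
    - intros; ring.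
    - now apply in_l2_lin. }
  rewrite (unitary_add _ HT (fun n => p * u n)%C (fun n => q * v n)%C) by auto.
  rewrite !(unitary_scal _ HT) by assumption; reflexivity.
Qed.

(** * The orbits of the group *)

Definition step (alpha : R) (n : nat) : R := sqrt ((INR n + 1) * (INR n + 1 + alpha)).

Lemma tau_0 (alpha : R) (u : cseq) :
  tau alpha u 0%nat = (RtoC (1 + alpha) * u 0%nat + RtoC (step alpha 0) * u 1%nat)%C.
Proof.
  unfold tau, step; simpl INR.
  replace (2 * 0 + 1 + alpha) with (1 + alpha) by ring; ring.
Qed.

Lemma tau_S (alpha : R) (u : cseq) (n : nat) :
  tau alpha u (S n) = (RtoC (step alpha n) * u n
    + RtoC (2 * INR (S n) + 1 + alpha) * u (S n) + RtoC (step alpha (S n)) * u (S (S n)))%C.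
Proof. unfold tau, step; rewrite !(S_INR n); reflexivity. Qed.

Lemma tau_lin (alpha : R) (p q : C) (u v : cseq) (n : nat) :
  tau alpha (fun n => p * u n + q * v n)%C n = (p * tau alpha u n + q * tau alpha v n)%C.
Proof. destruct n as [|n]; [rewrite !tau_0 | rewrite !tau_S]; ring. Qed.

(** Splitting into real and imaginary parts makes the rules for real derivatives directly
    available. *)
Definition is_Cderive (f : R -> C) (t : R) (l : C) : Prop :=
  is_derive (fun s => Re (f s)) t (Re l) /\ is_derive (fun s => Im (f s)) t (Im l).

Lemma is_Cderive_quotient (f : R -> C) (t : R) (l : C) :
  (forall eps, 0 < eps -> exists d, 0 < d /\ forall h, h <> 0 -> Rabs h < d ->
     Cmod ((f (t + h)%R - f t) / RtoC h - l)%C < eps) ->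
  is_Cderive f t l.
Proof.
  intros H; split; apply is_derive_Reals; intros eps Heps;
    destruct (H eps Heps) as [d [Hd Hl]]; exists (mkposreal d Hd); intros h Hh Hhd;
    specialize (Hl h Hh Hhd); eapply Rle_lt_trans; try exact Hl.
  - eapply Rle_trans; [|apply re_le_Cmod]; right; f_equal.
    unfold Cdiv; rewrite <- RtoC_inv by assumption.
    destruct (f (t + h)), (f t), l; simpl; field; assumption.
  - eapply Rle_trans; [|eapply Rle_trans; [apply Rmax_r | apply Rmax_Cmod]]; right; f_equal.
    unfold Cdiv; rewrite <- RtoC_inv by assumption.
    destruct (f (t + h)), (f t), l; simpl; field; assumption.
Qed.

Section orbits.

Variables (alpha : R) (U : R -> cseq -> cseq).
Hypothesis hU : is_unitary_group (H_dom alpha) (tau alpha) U.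

Let Hun (t : R) : unitary (U t) := group_unitary _ _ _ hU t.

Lemma in_l2_quotient (p : C) (u v w : cseq) : in_l2 u -> in_l2 v -> in_l2 w ->
  in_l2 (fun n => (u n - v n) / p - (- Ci * w n))%C.
Proof.
  intros Hu Hv Hw.
  apply in_l2_ext with (fun n => 1 * (/ p * u n + (- / p) * v n) + Ci * w n)%C.
  - intros; unfold Cdiv; ring.
  - apply in_l2_lin; [now apply (in_l2_lin (/ p) (- / p)) | assumption].
Qed.

(** [U t] preserves norms and commutes with [U h], so the difference quotient at [U t u] has the
    same error norm as the one at [u]. Reading [group_generator] from right to left then yields both
    the domain and the commutation. *)
Lemma orbit_domain (t : R) (u : cseq) : H_dom alpha u ->
  H_dom alpha (U t u) /\ tau alpha (U t u) = U t (tau alpha u).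
Proof.
  intros [Hu Htu].
  apply (group_generator _ _ _ hU); try now apply (unitary_l2 _ (Hun t)).
  destruct (group_generator _ _ _ hU u (tau alpha u) Hu Htu) as [H _].
  apply is_lim_ext with (2 := H (conj (conj Hu Htu) eq_refl)); intros h.
  rewrite <- (unitary_norm _ (Hun t)) by (apply in_l2_quotient; auto;
    now apply (unitary_l2 _ (Hun h))).
  f_equal.
  replace (fun n => (U h u n - u n) / RtoC h - - Ci * tau alpha u n)%C
    with (fun n => 1 * (/ RtoC h * U h u n + (- / RtoC h) * u n) + Ci * tau alpha u n)%C
    by (apply functional_extensionality; intros; unfold Cdiv; ring).
  assert (Hh : in_l2 (U h u)) by now apply (unitary_l2 _ (Hun h)).
  rewrite (unitary_lin _ _ _ (fun n => / RtoC h * U h u n + (- / RtoC h) * u n)%C)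
    by (auto; now apply in_l2_lin).
  rewrite (unitary_lin _ (/ RtoC h)) by auto.
  rewrite <- !(group_add _ _ _ hU) by assumption; rewrite (Rplus_comm t h).
  rewrite (group_add _ _ _ hU) by assumption.
  apply functional_extensionality; intros; unfold Cdiv; ring.
Qed.

(** Convergence of the difference quotient in l2 norm dominates convergence of each component. *)
Lemma orbit_derive (u : cseq) (n : nat) (t : R) : H_dom alpha u ->
  is_Cderive (fun s => U s u n) t (- Ci * tau alpha (U t u) n)%C.
Proof.
  intros Hu; destruct (orbit_domain t u Hu) as [[Hv Htv] _].
  destruct (group_generator _ _ _ hU _ _ Hv Htv) as [H _].
  specialize (H (conj (conj Hv Htv) eq_refl)).
  apply (is_Cderive_quotient (fun s => U s u n)); intros eps Heps.
  apply is_lim_spec in H; destruct (H (mkposreal eps Heps)) as [d Hd].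
  exists d; split; [apply cond_pos|]; intros h Hh Hhd.
  assert (Hb : ball 0 d h).
  { unfold ball; simpl; unfold AbsRing_ball, abs, minus, plus, opp; simpl.
    now rewrite Ropp_0, Rplus_0_r. }
  specialize (Hd h Hb Hh); simpl in Hd; rewrite Rminus_0_r in Hd.
  eapply Rle_lt_trans; [|exact Hd].
  eapply Rle_trans; [|apply Rle_abs].
  rewrite (Rplus_comm t h), (group_add _ _ _ hU) by apply Hu.
  apply (Cmod_le_l2_norm (fun n => (U h (U t u) n - U t u n) / RtoC h
    - (- Ci * tau alpha (U t u) n))%C).
  apply in_l2_quotient; auto; now apply (unitary_l2 _ (Hun h)).
Qed.

End orbits.

(** * Uniqueness of bounded solutions *)

Lemma Cmod2_pair (z : C) : Cmod z ^ 2 = Re z * Re z + Im z * Im z.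
Proof. rewrite Cmod2_alt; ring. Qed.

Lemma step_le (alpha : R) (n : nat) : 0 <= alpha -> 0 <= step alpha n <= INR n + 1 + alpha.
Proof.
  intros H; unfold step; pose proof (pos_INR n); split; [apply sqrt_pos|].
  apply Rle_trans with (sqrt ((INR n + 1 + alpha) ^ 2)).
  - apply sqrt_le_1_alt; nra.
  - right; apply sqrt_pow2; lra.
Qed.

(** [tau] is a real symmetric tridiagonal matrix: diagonal entries contribute nothing, couplings
    inside the block cancel in pairs, and only the flux between [N] and [S N] survives. *)
Lemma truncated_norm_derive (alpha : R) (y : R -> cseq) (t : R) (N : nat) :
  (forall n, is_Cderive (fun s => y s n) t (- Ci * tau alpha (y t) n)%C) ->
  is_derive (fun s => sum_n (fun n => Cmod (y s n) ^ 2) N) t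
    (2 * step alpha N * (Re (y t N) * Im (y t (S N)) - Im (y t N) * Re (y t (S N)))).
Proof.
  intros H.
  assert (Hn : forall n, is_derive (fun s => Cmod (y s n) ^ 2) t
    (2 * (Re (y t n) * Im (tau alpha (y t) n) - Im (y t n) * Re (tau alpha (y t) n)))).
  { intros n; destruct (H n) as [H1 H2].
    apply is_derive_ext with (fun s => Re (y s n) * Re (y s n) + Im (y s n) * Im (y s n));
      [intros; symmetry; apply Cmod2_pair|].
    evar_last; [apply (is_derive_plus (V := R_NormedModule));
      apply Derive.is_derive_mult; eassumption|].
    unfold plus; simpl; ring. }
  induction N as [|N IH].
  - apply is_derive_ext with (fun s => Cmod (y s 0%nat) ^ 2);
      [intros; now rewrite sum_O|].
    evar_last; [apply Hn|]; rewrite tau_0.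
    destruct (y t 0%nat), (y t 1%nat); simpl; ring.
  - apply is_derive_ext with (fun s => sum_n (fun n => Cmod (y s n) ^ 2) N + Cmod (y s (S N)) ^ 2);
      [intros; now rewrite sum_Sn|].
    evar_last; [apply (is_derive_plus (V := R_NormedModule)); [apply IH | apply Hn]|].
    rewrite tau_S; unfold plus; simpl.
    destruct (y t N), (y t (S N)), (y t (S (S N))); simpl; ring.
Qed.

(** Quantitative divergence of the harmonic series, by telescoping [ln (x + 1) - ln x <= / x]. *)
Lemma ln_le_harmonic (beta : R) (N : nat) : 0 < beta ->
  ln (INR N + 1 + beta) - ln beta <= sum_n (fun n => / (INR n + beta)) N.
Proof.
  intros Hb.
  assert (Hstep : forall x, 0 < x -> ln (x + 1) - ln x <= / x).
  { intros x Hx; rewrite <- ln_div by lra.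
    replace ((x + 1) / x) with (1 + / x) by (field; lra).
    pose proof (Rinv_0_lt_compat x Hx).
    rewrite <- (ln_exp (/ x)) at 2; apply ln_le; [lra | apply exp_ineq1_le]. }
  induction N as [|N IH].
  - rewrite sum_O; simpl; specialize (Hstep beta Hb).
    rewrite !Rplus_0_l, Rplus_comm; exact Hstep.
  - rewrite sum_Sn, !S_INR; change (@plus _ ?a ?b) with (a + b); pose proof (pos_INR N).
    specialize (Hstep (INR N + 1 + beta)).
    replace (INR N + 1 + 1 + beta) with (INR N + 1 + beta + 1) by ring. lra.
Qed.

Lemma tau_flow_unique (alpha : R) (y : R -> cseq) (t B : R) :
  0 <= alpha ->
  (forall n s, is_Cderive (fun s => y s n) s (- Ci * tau alpha (y s) n)%C) ->
  (forall n, y 0 n = RtoC 0) ->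
  (forall s N, Rabs s <= Rabs t -> sum_n (fun n => Cmod (y s n) ^ 2) N <= B) ->
  forall n, y t n = RtoC 0.
Proof.
  intros Hal Hy H0 HB n0.
  set (E := fun N s => sum_n (fun n => Cmod (y s n) ^ 2) N).
  set (w := fun N => INR N + (1 + alpha)).
  assert (Hw : forall N, 0 < w N) by (intros N; unfold w; pose proof (pos_INR N); lra).
  assert (HE0 : forall N, E N 0 = 0).
  { intros N; unfold E; induction N as [|N IH].
    - rewrite sum_O, H0, Cmod_0; simpl; lra.
    - rewrite sum_Sn, IH, H0, Cmod_0; unfold plus; simpl; lra. }
  (* Mean value inequality, uniform in [M]: the flux divided by [w N] is at most |y_N|^2 +
     |y_(N+1)|^2, and the two resulting sums are each at most [B]. *)
  assert (Hbound : forall M, sum_n (fun N => / w N * E N t) M <= 2 * B * Rabs t).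
  { intros M.
    set (dE := fun N s => 2 * step alpha N
      * (Re (y s N) * Im (y s (S N)) - Im (y s N) * Re (y s (S N)))).
    pose proof (bounded_variation (fun s => sum_n (fun N => / w N * E N s) M)
      (fun s => sum_n (fun N => / w N * dE N s) M) (2 * B) 0 t) as Hv.
    assert (Hz : sum_n (fun N => / w N * E N 0) M = 0).
    { rewrite (sum_n_ext _ (fun _ => 0)); [now rewrite sum_n_const, Rmult_0_r|].
      intros; now rewrite HE0, Rmult_0_r. }
    cbv beta in Hv; rewrite Hz, !Rminus_0_r in Hv.
    eapply Rle_trans; [apply Rle_abs | apply Hv].
    intros s Hs; rewrite Rminus_0_r in Hs; split.
    - apply (is_derive_sum_n (V := R_NormedModule) (fun N s => / w N * E N s)).
      intros N _; apply is_derive_scal, truncated_norm_derive; intros; apply Hy.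
    - eapply Rle_trans; [apply (norm_sum_n_m (V := R_NormedModule))|].
      apply Rle_trans with (sum_n (fun N => Cmod (y s N) ^ 2 + Cmod (y s (S N)) ^ 2) M).
      + apply sum_n_m_le; intros N.
        change (@norm _ _ ?x) with (Rabs x); unfold dE.
        destruct (step_le alpha N Hal) as [Hs0 Hs1].
        rewrite !Cmod2_pair; specialize (Hw N).
        set (p := Re (y s N)); set (q := Im (y s N));
          set (p' := Re (y s (S N))); set (q' := Im (y s (S N))).
        rewrite Rabs_mult, Rabs_right by (apply Rle_ge, Rlt_le, Rinv_0_lt_compat, Hw).
        apply (Rmult_le_reg_l (w N)); [exact Hw|].
        rewrite <- Rmult_assoc, Rinv_r, Rmult_1_l by lra.
        rewrite Rabs_mult, Rabs_right by lra.
        assert (Hc : 2 * Rabs (p * q' - q * p') <= p * p + q * q + (p' * p' + q' * q')).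
        { pose proof (Rle_0_sqr (p - q')); pose proof (Rle_0_sqr (q + p'));
          pose proof (Rle_0_sqr (p + q')); pose proof (Rle_0_sqr (q - p')).
          unfold Rsqr in *; unfold Rabs; destruct Rcase_abs; lra. }
        pose proof (Rabs_pos (p * q' - q * p')).
        unfold w in *; nra.
      + rewrite (sum_n_plus (G := R_AbelianMonoid)); unfold plus; simpl.
        assert (Hsh : sum_n (fun n => Cmod (y s (S n)) ^ 2) M
          <= sum_n (fun n => Cmod (y s n) ^ 2) (S M)).
        { clear; induction M as [|M IH].
          - rewrite sum_Sn, !sum_O; unfold plus; simpl.
            pose proof (pow2_ge_0 (Cmod (y s 0%nat))); simpl in *; lra.
          - rewrite sum_Sn, (sum_Sn _ (S M)); unfold plus in *; simpl in *; lra. }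
        pose proof (HB s M Hs); pose proof (HB s (S M) Hs); simpl in *; lra. }
  destruct (Ceq_dec (y t n0) 0) as [Hz|Hz]; [exact Hz|exfalso].
  apply Cmod_gt_0 in Hz.
  set (e := Cmod (y t n0) ^ 2).
  assert (He : 0 < e) by (unfold e; nra).
  (* For [N >= n0] one has [E N t >= e]; the terms up to [n0] are given up. *)
  assert (Hlow : forall M, e * (sum_n (fun N => / w N) M - sum_n (fun N => / w N) n0)
    <= sum_n (fun N => / w N * E N t) M).
  { assert (HEpos : forall N, 0 <= E N t).
    { intros N; apply Rle_trans with (Cmod (y t 0%nat) ^ 2); [apply pow2_ge_0|].
      apply (term_le_sum_n (fun n => Cmod (y t n) ^ 2)); [intros; apply pow2_ge_0 | lia]. }
    assert (Hinv : forall N, 0 < / w N) by (intros; apply Rinv_0_lt_compat, Hw).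
    assert (Hpos : forall M, 0 <= sum_n (fun N => / w N * E N t) M).
    { intros M; apply Rle_trans with (/ w 0%nat * E 0%nat t).
      - apply Rmult_le_pos; [apply Rlt_le, Hinv | apply HEpos].
      - apply (term_le_sum_n (fun N => / w N * E N t)); [|lia].
        intros; apply Rmult_le_pos; [apply Rlt_le, Hinv | apply HEpos]. }
    intros M; destruct (Nat.le_gt_cases n0 M) as [HM|HM].
    - induction HM as [|M HM IH]; [rewrite Rminus_diag_eq, Rmult_0_r; auto|].
      rewrite !sum_Sn; unfold plus; simpl.
      assert (e <= E (S M) t)
        by (apply (term_le_sum_n (fun n => Cmod (y t n) ^ 2)); [intros; apply pow2_ge_0 | lia]).
      specialize (Hinv (S M)); nra.
    - apply Rle_trans with 0; [|apply Hpos].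
      assert (sum_n (fun N => / w N) M <= sum_n (fun N => / w N) n0); [|nra].
      apply sum_n_mono; [intros; apply Rlt_le, Hinv | lia]. }
  (* Once the logarithm exceeds [X], the lower bound beats the upper one by [e], which comes from
     the summand 1; [ln (1 + alpha)] offsets the lower end in [ln_le_harmonic]. *)
  set (X := 2 * B * Rabs t / e + sum_n (fun N => / w N) n0 + 1 + ln (1 + alpha)).
  destruct (nfloor_ex (exp X)) as [M [_ HM]]; [apply Rlt_le, exp_pos|].
  assert (HX : X < ln (INR M + 1 + (1 + alpha))).
  { rewrite <- (ln_exp X); apply ln_increasing; [apply exp_pos| lra]. }
  pose proof (ln_le_harmonic (1 + alpha) M ltac:(lra)) as Hh.
  specialize (Hlow M); specialize (Hbound M).
  assert (Hfin : e * (2 * B * Rabs t / e + 1) <= 2 * B * Rabs t).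
  { eapply Rle_trans; [|exact Hbound]; eapply Rle_trans; [|exact Hlow].
    apply Rmult_le_compat_l; [lra|]; unfold X, w in *; lra. }
  replace (e * (2 * B * Rabs t / e + 1)) with (2 * B * Rabs t + e) in Hfin by (field; lra).
  lra.
Qed.

(** * Complex-valued derivatives and the explicit flow parameters *)

Lemma is_Cderive_lin (p q : C) (f g : R -> C) (t : R) (l m : C) :
  is_Cderive f t l -> is_Cderive g t m ->
  is_Cderive (fun s => p * f s + q * g s)%C t (p * l + q * m)%C.
Proof.
  intros [Hf1 Hf2] [Hg1 Hg2]; split.
  - apply is_derive_ext with (fun s => (Re p * Re (f s) + (- Im p) * Im (f s))
      + (Re q * Re (g s) + (- Im q) * Im (g s))); [intros; unfold Re, Im; simpl; ring|].
    evar_last; [apply (is_derive_plus (V := R_NormedModule));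
      apply (is_derive_plus (V := R_NormedModule)); apply is_derive_scal; eassumption|].
    unfold plus, Re, Im; simpl; ring.
  - apply is_derive_ext with (fun s => (Re p * Im (f s) + Im p * Re (f s))
      + (Re q * Im (g s) + Im q * Re (g s))); [intros; unfold Re, Im; simpl; ring|].
    evar_last; [apply (is_derive_plus (V := R_NormedModule));
      apply (is_derive_plus (V := R_NormedModule)); apply is_derive_scal; eassumption|].
    unfold plus, Re, Im; simpl; ring.
Qed.

Lemma is_Cderive_mult (f g : R -> C) (t : R) (l m : C) :
  is_Cderive f t l -> is_Cderive g t m ->
  is_Cderive (fun s => f s * g s)%C t (l * g t + f t * m)%C.
Proof.
  intros [Hf1 Hf2] [Hg1 Hg2]; split.
  - apply is_derive_ext with (fun s => Re (f s) * Re (g s) + (- 1) * (Im (f s) * Im (g s)));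
      [intros; unfold Re, Im; simpl; ring|].
    evar_last; [apply (is_derive_plus (V := R_NormedModule)); [|apply is_derive_scal];
      apply Derive.is_derive_mult; eassumption|].
    unfold plus, Re, Im; simpl; ring.
  - apply is_derive_ext with (fun s => Re (f s) * Im (g s) + Im (f s) * Re (g s));
      [intros; unfold Re, Im; simpl; ring|].
    evar_last; [apply (is_derive_plus (V := R_NormedModule));
      apply Derive.is_derive_mult; eassumption|].
    unfold plus, Re, Im; simpl; ring.
Qed.

Lemma is_Cderive_ext (f g : R -> C) (t : R) (l m : C) :
  is_Cderive f t l -> (forall s, f s = g s) -> l = m -> is_Cderive g t m.
Proof.
  intros Hf H <-; now replace g with f by (apply functional_extensionality, H).
Qed.

Lemma is_Cderive_const (c : C) (t : R) : is_Cderive (fun _ => c) t 0%C.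
Proof. split; apply (is_derive_const (V := R_NormedModule)). Qed.

Lemma is_Cderive_pow_S (f : R -> C) (t : R) (l : C) (n : nat) :
  is_Cderive f t l ->
  is_Cderive (fun s => (f s ^ S n)%C) t (RtoC (INR (S n)) * f t ^ n * l)%C.
Proof.
  intros Hf; induction n as [|n IH].
  - assert (H := is_Cderive_mult _ _ _ _ _ Hf (is_Cderive_const 1%C t)).
    apply (is_Cderive_ext _ _ _ _ _ H); intros; simpl; ring.
  - assert (H := is_Cderive_mult _ _ _ _ _ Hf IH).
    apply (is_Cderive_ext _ _ _ _ _ H); [reflexivity|].
    rewrite (S_INR (S n)), RtoC_plus, Cpow_S; ring.
Qed.

(** [cayley t = i t / (1 + i t)] and [amplitude alpha t = (1 + i t)^(-1-alpha)]. *)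
Definition cayley (t : R) : C := (t ^ 2 / (1 + t ^ 2), t / (1 + t ^ 2)).

Definition amplitude (alpha t : R) : C :=
  (Rpower (1 / (1 + t ^ 2)) ((1 + alpha) / 2) * cos ((1 + alpha) * atan t),
   - (Rpower (1 / (1 + t ^ 2)) ((1 + alpha) / 2) * sin ((1 + alpha) * atan t))).

Lemma one_plus_sqr_pos (t : R) : 0 < 1 + t ^ 2.
Proof. pose proof (pow2_ge_0 t); lra. Qed.

Lemma cayley_circle (t : R) : Re (cayley t) = Re (cayley t) ^ 2 + Im (cayley t) ^ 2.
Proof. pose proof (one_plus_sqr_pos t); simpl; field; simpl in *; lra. Qed.

Lemma Cmod_amplitude (alpha t : R) :
  Cmod (amplitude alpha t) = Rpower (1 / (1 + t ^ 2)) ((1 + alpha) / 2).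
Proof.
  unfold Cmod, amplitude; cbn [fst snd].
  set (r := Rpower _ _).
  replace ((r * cos ((1 + alpha) * atan t)) ^ 2 + (- (r * sin ((1 + alpha) * atan t))) ^ 2)
    with (r ^ 2 * (Rsqr (sin ((1 + alpha) * atan t)) + Rsqr (cos ((1 + alpha) * atan t))))
    by (unfold Rsqr; ring).
  rewrite sin2_cos2, Rmult_1_r; apply sqrt_pow2, Rlt_le, exp_pos.
Qed.

Lemma amplitude_le_1 (alpha t : R) : 0 <= alpha -> Cmod (amplitude alpha t) <= 1.
Proof.
  intros Hal; rewrite Cmod_amplitude; unfold Rpower.
  apply Rnot_lt_le; intros H; rewrite <- exp_0 in H at 1; apply exp_lt_inv in H.
  pose proof (one_plus_sqr_pos t).
  assert (Hln : ln (1 / (1 + t ^ 2)) <= 0).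
  { rewrite <- ln_1; apply ln_le; [apply Rdiv_lt_0_compat; lra|].
    apply Rle_div_l; [lra|]; pose proof (pow2_ge_0 t); lra. }
  assert (Hc : 0 <= (1 + alpha) / 2) by lra.
  pose proof (Rmult_le_compat_l _ _ _ Hc Hln); lra.
Qed.

(** For [z = - cayley t] this is the Moebius flow z' = - i (1 + z)^2. *)
Lemma cayley_derive (t : R) : is_Cderive cayley t (Ci * (1 - cayley t) ^ 2)%C.
Proof.
  pose proof (one_plus_sqr_pos t).
  split; simpl; auto_derive; try (simpl in *; lra); simpl; field; simpl in *; lra.
Qed.

Lemma amplitude_derive (alpha t : R) :
  is_Cderive (amplitude alpha) t
    (- Ci * RtoC (1 + alpha) * (1 - cayley t) * amplitude alpha t)%C.
Proof.
  pose proof (one_plus_sqr_pos t) as Ht.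
  assert (Hr : is_derive (fun s => Rpower (1 / (1 + s ^ 2)) ((1 + alpha) / 2)) t
    (- (1 + alpha) * t / (1 + t ^ 2) * Rpower (1 / (1 + t ^ 2)) ((1 + alpha) / 2))).
  { unfold Rpower; auto_derive.
    - split; [simpl in *; lra|split; [|exact I]].
      apply Rdiv_lt_0_compat; simpl in *; lra.
    - set (X := exp _); field; simpl in *; lra. }
  assert (Hph : is_derive (fun s => (1 + alpha) * atan s) t ((1 + alpha) / (1 + t ^ 2))).
  { auto_derive; [exact I|]; unfold Rsqr; field; simpl in *; lra. }
  assert (Hc : is_derive (fun s => cos ((1 + alpha) * atan s)) t
    (- sin ((1 + alpha) * atan t) * ((1 + alpha) / (1 + t ^ 2)))).
  { evar_last; [apply (is_derive_comp cos); [apply is_derive_cos | exact Hph]|].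
    unfold scal; simpl; unfold mult; simpl; ring. }
  assert (Hs : is_derive (fun s => sin ((1 + alpha) * atan s)) t
    (cos ((1 + alpha) * atan t) * ((1 + alpha) / (1 + t ^ 2)))).
  { evar_last; [apply (is_derive_comp sin); [apply is_derive_sin | exact Hph]|].
    unfold scal; simpl; unfold mult; simpl; ring. }
  split; cbn [Re Im fst snd amplitude].
  - evar_last; [apply Derive.is_derive_mult; eassumption|].
    cbn [Re Im fst snd amplitude Cmult Copp Cminus Cplus Ci RtoC cayley].
    field; simpl in *; lra.
  - evar_last; [apply (is_derive_opp (V := R_NormedModule)), Derive.is_derive_mult; eassumption|].
    cbn [Re Im fst snd amplitude Cmult Copp Cminus Cplus Ci RtoC cayley].
    unfold opp; simpl; field; simpl in *; lra.
Qed.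

(** * The weights and the coherent states *)

Lemma sigma_binom (alpha : R) (n : nat) : sigma_seq alpha n = sqrt (binom alpha n).
Proof. reflexivity. Qed.

Section weights.

Variable alpha : R.
Hypothesis halpha : 0 <= alpha.

Lemma sigma_sqr (n : nat) : sigma_seq alpha n * sigma_seq alpha n = binom alpha n.
Proof. apply sqrt_sqrt, Rlt_le, binom_pos; lra. Qed.

Lemma binom_ge_1 (n : nat) : 1 <= binom alpha n.
Proof.
  induction n as [|n IH]; [rewrite binom_0; lra|].
  pose proof (binom_S alpha n); pose proof (pos_INR n); nra.
Qed.

Lemma sigma_ge_1 (n : nat) : 1 <= sigma_seq alpha n.
Proof. rewrite <- sqrt_1; apply sqrt_le_1_alt, binom_ge_1. Qed.

Lemma sigma_0 : sigma_seq alpha 0 = 1.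
Proof. rewrite sigma_binom, binom_0; apply sqrt_1. Qed.

(** Together with [step_sigma_S], this removes the square roots: conjugating [tau] by the weights
    leaves coefficients that are affine in [n]. *)
Lemma step_sigma (n : nat) :
  step alpha n * sigma_seq alpha n = (INR n + 1) * sigma_seq alpha (S n).
Proof.
  pose proof (pos_INR n); pose proof (binom_ge_1 n); pose proof (binom_ge_1 (S n)).
  unfold step; rewrite !sigma_binom, <- sqrt_mult_alt by nra.
  rewrite <- (sqrt_pow2 (INR n + 1)) at 3 by lra.
  rewrite <- sqrt_mult_alt by nra; f_equal.
  pose proof (binom_S alpha n); nra.
Qed.

Lemma step_sigma_S (n : nat) :
  step alpha n * sigma_seq alpha (S n) = (INR n + 1 + alpha) * sigma_seq alpha n.
Proof.
  pose proof (pos_INR n); pose proof (binom_ge_1 n); pose proof (binom_ge_1 (S n)).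
  unfold step; rewrite !sigma_binom, <- sqrt_mult_alt by nra.
  transitivity (sqrt ((INR n + 1 + alpha) ^ 2) * sqrt (binom alpha n)).
  - rewrite <- sqrt_mult_alt by nra; f_equal.
    pose proof (binom_S alpha n); nra.
  - f_equal; apply sqrt_pow2; lra.
Qed.

Lemma step_pos (n : nat) : 0 < step alpha n.
Proof. pose proof (pos_INR n); apply sqrt_lt_R0; nra. Qed.

Definition coherent (t : R) : cseq := fun n =>
  (amplitude alpha t * (RtoC (sigma_seq alpha n) * (- cayley t) ^ n))%C.

(** On sequences [sigma(n) z^n], [tau] acts as (1 + z)^2 d/dz + (1 + alpha) (1 + z), taken at
    [z = - cayley t]. The [match] encodes [n z^(n-1)] without a negative exponent. *)
Lemma tau_coherent (t : R) (n : nat) :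
  (tau alpha (coherent t) n = amplitude alpha t * RtoC (sigma_seq alpha n) *
   ((RtoC (INR n) * match n with O => 0 | S k => (- cayley t) ^ k end) * (1 - cayley t) ^ 2
    + RtoC (1 + alpha) * (1 - cayley t) * (- cayley t) ^ n))%C.
Proof.
  unfold coherent; destruct n as [|n].
  - rewrite tau_0.
    assert (H := f_equal RtoC (step_sigma_S 0)); rewrite !RtoC_mult in H; simpl INR in *.
    rewrite Rplus_0_l in H.
    apply (Ceq_of_zero _ _ _ ((amplitude alpha t * - cayley t) · H)); simpl; ring.
  - rewrite tau_S.
    assert (H1 := f_equal RtoC (step_sigma n)).
    assert (H2 := f_equal RtoC (step_sigma_S (S n))).
    rewrite <- (S_INR n) in H1.
    replace (2 * INR (S n) + 1 + alpha) with (2 * INR (S n) + (1 + alpha)) by ring.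
    replace (INR (S n) + 1 + alpha) with (INR (S n) + (1 + alpha)) in H2 by ring.
    rewrite ?RtoC_plus, ?RtoC_mult, ?RtoC_plus in *.
    apply (Ceq_of_zero _ _ _ ((amplitude alpha t * (- cayley t) ^ n) · H1
      ⊕ (amplitude alpha t * (- cayley t) ^ S (S n)) · H2)); rewrite !Cpow_S; ring.
Qed.

Lemma coherent_derive (n : nat) (t : R) :
  is_Cderive (fun s => coherent s n) t (- Ci * tau alpha (coherent t) n)%C.
Proof.
  rewrite tau_coherent; unfold coherent.
  assert (Hz : is_Cderive (fun s => (- cayley s)%C) t (- (Ci * (1 - cayley t) ^ 2))%C).
  { assert (H := is_Cderive_lin (- (1)) 0 _ _ t _ _ (cayley_derive t) (cayley_derive t)).
    apply (is_Cderive_ext _ _ _ _ _ H); intros; ring. }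
  assert (Hp : is_Cderive (fun s => (- cayley s) ^ n)%C t
    (- (Ci * (1 - cayley t) ^ 2)
      * (RtoC (INR n) * match n with O => 0 | S k => (- cayley t) ^ k end))%C).
  { destruct n as [|n].
    - apply (is_Cderive_ext _ _ _ _ _ (is_Cderive_const 1%C t)); [reflexivity|].
      simpl INR; ring.
    - rewrite Cmult_comm; now apply is_Cderive_pow_S. }
  assert (H := is_Cderive_mult _ _ _ _ _ (amplitude_derive alpha t)
    (is_Cderive_mult _ _ _ _ _ (is_Cderive_const (RtoC (sigma_seq alpha n)) t) Hp)).
  apply (is_Cderive_ext _ _ _ _ _ H); [reflexivity | ring].
Qed.

Lemma ex_series_binom_geom (q : R) : 0 < q < 1 -> ex_series (fun n => binom alpha n * q ^ n).
Proof.
  intros Hq.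
  apply ex_series_ext with (fun n => Rabs (binom alpha n * q ^ n)).
  { intros n; apply Rabs_right, Rle_ge, Rmult_le_pos;
      [pose proof (binom_ge_1 n); lra | apply pow_le; lra]. }
  apply (ex_series_DAlembert _ q); [apply Hq| |].
  - intros n; apply Rgt_not_eq, Rmult_lt_0_compat; [pose proof (binom_ge_1 n); lra|].
    apply pow_lt, Hq.
  - apply is_lim_seq_ext with (fun n => q * (1 + alpha * / INR (S n))).
    { intros n; rewrite S_INR; pose proof (pos_INR n); pose proof (binom_ge_1 n).
      pose proof (pow_lt q n (proj1 Hq)).
      assert (Hb : binom alpha (S n) = (INR n + 1 + alpha) / (INR n + 1) * binom alpha n).
      { apply Rmult_eq_reg_l with (INR n + 1); [|lra].
        rewrite binom_S; field; lra. }
      rewrite Hb; simpl pow.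
      rewrite Rabs_right.
      - field; repeat split; lra.
      - apply Rle_ge. replace (_ / _) with (q * ((INR n + 1 + alpha) / (INR n + 1)))
          by (field; repeat split; lra).
        apply Rmult_le_pos; [lra|]; apply Rlt_le, Rdiv_lt_0_compat; lra. }
    assert (L0 : is_lim_seq (fun n => / INR (S n)) 0).
    { apply (is_lim_seq_incr_1 (fun n => / INR n)).
      evar_last; [apply is_lim_seq_inv; [apply is_lim_seq_INR | discriminate]|reflexivity]. }
    assert (L1 : is_lim_seq (fun n => alpha * / INR (S n)) (alpha * 0))
      by exact (is_lim_seq_scal_l _ alpha 0 L0).
    evar_last; [exact (is_lim_seq_scal_l _ q (1 + alpha * 0)
      (is_lim_seq_plus' _ _ _ _ (is_lim_seq_const 1) L1))|].
    simpl; f_equal; ring.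
Qed.

Lemma coherent_sum_bound (t : R) : exists B, forall s N, Rabs s <= Rabs t ->
  sum_n (fun n => Cmod (coherent s n) ^ 2) N <= B.
Proof.
  (* Here |cayley s|^2 = s^2 / (1 + s^2) <= t^2 / (1 + t^2) < q. Unlike the middle term, [q] stays
     positive at [t = 0], so the ratio test has nonzero terms. *)
  set (q := (1 + t ^ 2) / (2 + t ^ 2)).
  pose proof (pow2_ge_0 t) as Ht.
  assert (Hq : 0 < q < 1).
  { unfold q; split; [apply Rdiv_lt_0_compat; lra | apply Rlt_div_l; lra]. }
  exists (Series (fun n => binom alpha n * q ^ n)); intros s N Hs.
  eapply Rle_trans; [|apply (sum_n_le_Series _ N);
    [intros n; apply Rmult_le_pos; [pose proof (binom_ge_1 n); lra | apply pow_le; lra]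
    | now apply ex_series_binom_geom]].
  apply sum_n_m_le; intros n; unfold coherent.
  rewrite !Cmod_mult, Cmod_pow, Cmod_opp, Cmod_R.
  pose proof (sigma_ge_1 n); rewrite Rabs_right by lra.
  assert (Hz : Cmod (cayley s) ^ 2 <= q).
  { rewrite Cmod2_alt, <- cayley_circle; simpl Re; unfold q.
    assert (Hst : s ^ 2 <= t ^ 2) by (rewrite <- !(pow2_abs s), <- (pow2_abs t);
      apply pow_incr; split; [apply Rabs_pos | exact Hs]).
    pose proof (one_plus_sqr_pos s).
    apply (Rmult_le_reg_r ((1 + s ^ 2) * (2 + t ^ 2))); [apply Rmult_lt_0_compat; lra|].
    transitivity (s ^ 2 * (2 + t ^ 2)); [right; simpl; field; simpl in *; lra|].
    transitivity ((1 + t ^ 2) * (1 + s ^ 2)); [|right; field; lra].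
    revert Hst; generalize (s ^ 2) (t ^ 2); intros; nra. }
  pose proof (amplitude_le_1 alpha s halpha); pose proof (Cmod_ge_0 (amplitude alpha s)).
  rewrite !Rpow_mult_distr, <- pow_mult, (Nat.mul_comm n 2), pow_mult.
  replace (sigma_seq alpha n ^ 2) with (binom alpha n) by (rewrite <- sigma_sqr; ring).
  assert (Hzn : (Cmod (cayley s) ^ 2) ^ n <= q ^ n).
  { apply pow_incr; split; [apply pow2_ge_0 | exact Hz]. }
  pose proof (pow_le (Cmod (cayley s) ^ 2) n (pow2_ge_0 _)).
  pose proof (binom_ge_1 n).
  rewrite <- (Rmult_1_l (binom alpha n * q ^ n)).
  apply Rmult_le_compat; [apply pow2_ge_0 | apply Rmult_le_pos; lra | nra
    | apply Rmult_le_compat_l; lra].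
Qed.

End weights.

(** * Matrix elements *)

Definition delta (m : nat) : cseq := fun n => if Nat.eqb n m then RtoC 1 else RtoC 0.

Lemma is_series_finite (a : nat -> R) (N : nat) :
  (forall n, (N < n)%nat -> a n = 0) -> is_series a (sum_n a N).
Proof.
  intros Ha.
  apply (is_lim_seq_ext_loc (fun _ => sum_n a N) (sum_n a) (sum_n a N)); [|apply is_lim_seq_const].
  exists N; intros n Hn; induction Hn as [|n Hn IH]; [reflexivity|].
  rewrite sum_Sn, <- IH, (Ha (S n)) by lia; symmetry; apply Rplus_0_r.
Qed.

Lemma delta_neq (m n : nat) : n <> m -> delta m n = RtoC 0.
Proof. intros H; unfold delta; now rewrite (proj2 (Nat.eqb_neq n m) H). Qed.

Lemma delta_eq (m : nat) : delta m m = RtoC 1.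
Proof. unfold delta; now rewrite Nat.eqb_refl. Qed.

Lemma in_l2_delta (m : nat) : in_l2 (delta m).
Proof.
  exists (sum_n (fun n => Cmod (delta m n) ^ 2) m); apply is_series_finite.
  intros n Hn; rewrite delta_neq, Cmod_0 by lia; simpl; ring.
Qed.

(** At [m = 0] the vector [delta (pred m)] carries the coefficient 0. The factor 1 nests the three
    terms as binary combinations, the shape of [in_l2_lin] and [unitary_lin]. *)
Lemma tau_delta (alpha : R) (m : nat) :
  tau alpha (delta m) = fun n => (1 * (match m with O => RtoC 0 | S k => RtoC (step alpha k) end
      * delta (pred m) n + RtoC (2 * INR m + 1 + alpha) * delta m n)
    + RtoC (step alpha m) * delta (S m) n)%C.
Proof.
  apply functional_extensionality; intros n.
  destruct n as [|n]; [rewrite tau_0 | rewrite tau_S].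
  - destruct m as [|[|m]]; unfold delta; simpl;
      try (replace (2 * 0 + 1 + alpha) with (1 + alpha) by ring); ring.
  - destruct (Nat.eq_dec n m) as [->|H1]; [|destruct (Nat.eq_dec (S n) m) as [<-|H2];
      [|destruct (Nat.eq_dec (S (S n)) m) as [<-|H3]]].
    + rewrite delta_eq, (delta_neq m (S m)), (delta_neq m (S (S m))), delta_eq by lia.
      destruct m; rewrite ?delta_neq by (simpl; lia); ring.
    + simpl pred; rewrite !delta_eq, !delta_neq by lia; ring.
    + simpl pred; rewrite !delta_eq, !delta_neq by lia; ring.
    + rewrite !(delta_neq m), !(delta_neq (S m)) by lia.
      destruct m as [|m]; [ring|]; simpl pred; rewrite delta_neq by lia; ring.
Qed.

Lemma H_dom_delta (alpha : R) (m : nat) : H_dom alpha (delta m).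
Proof.
  split; [apply in_l2_delta|]; rewrite tau_delta.
  pose proof in_l2_delta; apply (in_l2_lin 1); [now apply in_l2_lin | auto].
Qed.

Section matrix_elements.

Variables (alpha : R) (U : R -> cseq -> cseq).
Hypothesis halpha : 0 <= alpha.
Hypothesis hU : is_unitary_group (H_dom alpha) (tau alpha) U.

Lemma vacuum_orbit (t : R) (n : nat) : U t (delta 0) n = coherent alpha t n.
Proof.
  destruct (coherent_sum_bound alpha halpha t) as [B HB].
  set (y := fun s n => (1 * U s (delta 0) n + (- (1)) * coherent alpha s n)%C).
  assert (Hy : y t n = 0%C).
  { apply (tau_flow_unique alpha y t (2 * l2_norm (delta 0) ^ 2 + 2 * B) halpha).
    - intros k s; unfold y; rewrite tau_lin.
      replace (- Ci * _)%C with (1 * (- Ci * tau alpha (U s (delta 0)) k)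
        + - (1) * (- Ci * tau alpha (coherent alpha s) k))%C by ring.
      apply is_Cderive_lin; [|now apply coherent_derive].
      apply (orbit_derive alpha U hU); apply H_dom_delta.
    - intros k; unfold y; rewrite (group_zero _ _ _ hU) by apply in_l2_delta.
      assert (Ha : amplitude alpha 0 = 1%C).
      { unfold amplitude; rewrite atan_0, Rmult_0_r, cos_0, sin_0.
        unfold Rpower; replace (1 / (1 + 0 ^ 2)) with 1 by (simpl; field).
        rewrite ln_1, Rmult_0_r, exp_0; apply injective_projections; simpl; ring. }
      assert (Hc : (- cayley 0 = 0)%C)
        by (apply injective_projections; simpl; field).
      unfold coherent; rewrite Ha, Hc; destruct k as [|k].
      + rewrite delta_eq, sigma_0 by assumption; simpl; ring.
      + rewrite delta_neq, Cpow_S by lia; ring.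
    - intros s N Hs; specialize (HB s N Hs).
      apply Rle_trans with (sum_n (fun n => 2 * Cmod (U s (delta 0) n) ^ 2
        + 2 * Cmod (coherent alpha s n) ^ 2) N).
      { apply sum_n_m_le; intros k; unfold y.
        eapply Rle_trans; [apply Cmod2_plus_le|].
        rewrite !Cmod_mult, Cmod_opp, Cmod_1, !Rmult_1_l; lra. }
      rewrite (sum_n_plus (G := R_AbelianMonoid)).
      rewrite !(sum_n_scal_l (K := R_Ring) (V := R_ModuleSpace)).
      change (2 * sum_n (fun k => Cmod (U s (delta 0) k) ^ 2) N
        + 2 * sum_n (fun k => Cmod (coherent alpha s k) ^ 2) N
        <= 2 * l2_norm (delta 0) ^ 2 + 2 * B).
      pose proof (in_l2_delta 0).
      rewrite <- (unitary_norm _ (group_unitary _ _ _ hU s) (delta 0)) by assumption.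
      assert (H1 := sum_Cmod2_le_l2_norm (U s (delta 0)) N
        (unitary_l2 _ (group_unitary _ _ _ hU s) _ H)).
      lra. }
  unfold y in Hy; apply (Ceq_of_zero _ _ _ Hy); ring.
Qed.

(** Since [step alpha m] is nonzero, H U delta_m = U H delta_m determines U delta_(m+1) from the two
    preceding columns; [contiguous] says that the kernel obeys the same three-term relation. *)
Lemma matrix_element (t : R) (m n : nat) :
  (RtoC (sigma_seq alpha n) * U t (delta m) n
   = amplitude alpha t * RtoC (sigma_seq alpha m) * kern alpha (cayley t) m n)%C.
Proof.
  assert (Hrec : mobius_rec (cayley t) (kern alpha (cayley t)))
    by apply conv_mobius_rec, disc_coef_rec.
  assert (Hcont := mobius_rec_contiguous alpha _ _ Hrec (kern_0_l alpha (cayley t))).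
  set (x := kern alpha (cayley t)) in *; set (c := amplitude alpha t).
  revert n.
  (* The three-term relation needs the columns [m - 1] and [m] together; at [m = 0] the two claims
     coincide. *)
  enough (H : (forall n, (RtoC (sigma_seq alpha n) * U t (delta (pred m)) n
      = c * RtoC (sigma_seq alpha (pred m)) * x (pred m) n)%C) /\
    forall n, (RtoC (sigma_seq alpha n) * U t (delta m) n
      = c * RtoC (sigma_seq alpha m) * x m n)%C) by apply H.
  induction m as [|m [IH0 IH1]].
  - assert (H : forall n, (RtoC (sigma_seq alpha n) * U t (delta 0) n
      = c * RtoC (sigma_seq alpha 0) * x 0%nat n)%C); [|now split].
    intros n; rewrite vacuum_orbit; unfold coherent, x; rewrite kern_0_l, sigma_0 by assumption.
    fold c; rewrite <- sigma_sqr, RtoC_mult by assumption; ring.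
  - split; [exact IH1|]; intros n.
    assert (Hst : RtoC (step alpha m) <> 0%C).
    { intros H; injection H; pose proof (step_pos alpha halpha m); lra. }
    destruct (orbit_domain alpha U hU t _ (H_dom_delta alpha m)) as [_ Hor].
    pose proof in_l2_delta as Hd; pose proof (group_unitary _ _ _ hU t) as Hun.
    rewrite tau_delta in Hor.
    rewrite (unitary_lin _ 1 _ (fun n => match m with O => RtoC 0 | S k => RtoC (step alpha k) end
      * delta (pred m) n + RtoC (2 * INR m + 1 + alpha) * delta m n)%C) in Hor
      by (auto; now apply in_l2_lin).
    rewrite (unitary_lin _ _ _ (delta (pred m))) in Hor by auto.
    assert (Hn := f_equal (fun u => u n) Hor); cbv beta in Hn; clear Hor.
    specialize (Hcont m n).
    assert (Htau : (RtoC (sigma_seq alpha n) * tau alpha (U t (delta m)) n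
      = c * RtoC (sigma_seq alpha m) * ((RtoC (INR n) + RtoC alpha) * upper (x m) n
        + (2 * RtoC (INR n) + 1 + RtoC alpha) * x m n + (RtoC (INR n) + 1) * x m (S n)))%C).
    { assert (S1 := f_equal RtoC (step_sigma alpha halpha n)).
      assert (F1 := IH1 n); assert (F2 := IH1 (S n)).
      rewrite !RtoC_mult, !RtoC_plus in S1.
      destruct n as [|k].
      - rewrite tau_0; simpl upper; simpl INR in *; rewrite RtoC_plus.
        apply (Ceq_of_zero _ _ _ ((1 + RtoC alpha) · F1 ⊕ 1 · F2
          ⊕ (U t (delta m) 1%nat) · S1)); ring.
      - assert (F0 := IH1 k).
        assert (S2 := f_equal RtoC (step_sigma_S alpha halpha k)).
        rewrite tau_S; simpl upper; rewrite <- (S_INR k) in S2.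
        rewrite !RtoC_plus, !RtoC_mult, ?RtoC_plus in *.
        apply (Ceq_of_zero _ _ _ ((RtoC (INR (S k)) + RtoC alpha) · F0
          ⊕ (2 * RtoC (INR (S k)) + 1 + RtoC alpha) · F1 ⊕ (RtoC (INR (S k)) + 1) · F2
          ⊕ (U t (delta m) (S (S k))) · S1 ⊕ (U t (delta m) k) · S2)); ring. }
    assert (S3 : (RtoC (step alpha m) * RtoC (sigma_seq alpha (S m))
        = (RtoC (INR m) + 1 + RtoC alpha) * RtoC (sigma_seq alpha m))%C).
    { rewrite <- RtoC_mult, step_sigma_S, RtoC_mult, !RtoC_plus by assumption; reflexivity. }
    assert (S4 : (match m with O => RtoC 0 | S k => RtoC (step alpha k) end
          * RtoC (sigma_seq alpha (pred m)) * x (pred m) n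
        = RtoC (INR m) * RtoC (sigma_seq alpha m) * match m with O => RtoC 0 | S k => x k n end)%C).
    { destruct m as [|k]; [ring|]; simpl pred.
      rewrite <- (RtoC_mult (step alpha k)), step_sigma, <- S_INR, RtoC_mult by assumption.
      ring. }
    rewrite Hn in Htau; clear Hn.
    rewrite !RtoC_plus, RtoC_mult in Htau.
    assert (F0 := IH0 n); assert (F1 := IH1 n).
    assert (Hfin : (RtoC (step alpha m) * (RtoC (sigma_seq alpha n) * U t (delta (S m)) n)
      = RtoC (step alpha m) * (c * RtoC (sigma_seq alpha (S m)) * x (S m) n))%C).
    { set (p := match m with O => RtoC 0 | S k => RtoC (step alpha k) end) in *.
      set (x' := match m with O => RtoC 0 | S k => x k n end) in *.
      apply (Ceq_of_zero _ _ _ (1 · Htau ⊕ (- p) · F0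
        ⊕ (- (2 * RtoC (INR m) + 1 + RtoC alpha)) · F1
        ⊕ (- c) · S4 ⊕ (- c * x (S m) n) · S3 ⊕ (c * RtoC (sigma_seq alpha m)) · Hcont)).
      ring. }
    assert (Hinv : forall z w, (RtoC (step alpha m) * z = RtoC (step alpha m) * w)%C -> z = w).
    { intros z w H; transitivity (/ RtoC (step alpha m) * (RtoC (step alpha m) * z))%C;
        [field; exact Hst | rewrite H; field; exact Hst]. }
    apply Hinv, Hfin.
Qed.

Lemma matrix_element_bound (t : R) (m n : nat) :
  Cmod (U t (delta m) n)
    <= Rpower (1 / (1 + t ^ 2)) ((1 + alpha) / 2) * (sigma_seq alpha m * sigma_seq alpha n).
Proof.
  assert (H := f_equal Cmod (matrix_element t m n)).
  rewrite !Cmod_mult, !Cmod_R, Cmod_amplitude in H.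
  pose proof (sigma_ge_1 alpha halpha m); pose proof (sigma_ge_1 alpha halpha n).
  rewrite !Rabs_right in H by lra.
  pose proof (Cmod_kern_le alpha (cayley t) m n halpha (cayley_circle t)) as Hk.
  rewrite <- sigma_sqr in Hk by assumption.
  set (r := Rpower _ _) in *.
  assert (Hr : 0 < r) by apply exp_pos.
  apply (Rmult_le_reg_l (sigma_seq alpha n)); [lra|]; rewrite H.
  replace (sigma_seq alpha n * (r * (sigma_seq alpha m * sigma_seq alpha n)))
    with (r * sigma_seq alpha m * (sigma_seq alpha n * sigma_seq alpha n)) by ring.
  apply Rmult_le_compat_l; [apply Rmult_le_pos; lra | exact Hk].
Qed.

End matrix_elements.

(** * The operator norm *)

Definition truncation (N : nat) (u : cseq) : cseq := fun n =>
  if Nat.leb n N then u n else RtoC 0.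

Lemma in_l2_truncation (N : nat) (u : cseq) : in_l2 (truncation N u).
Proof.
  eexists; apply (is_series_finite (fun n => Cmod (truncation N u n) ^ 2) N).
  intros n Hn; unfold truncation.
  rewrite (proj2 (Nat.leb_gt n N) Hn), Cmod_0; simpl; ring.
Qed.

Lemma unitary_truncation (T : cseq -> cseq) (N : nat) (u : cseq) (n : nat) :
  unitary T -> T (truncation N u) n = csum (fun m => u m * T (delta m) n)%C N.
Proof.
  intros HT; pose proof in_l2_delta as Hd.
  induction N as [|N IH].
  - rewrite csum_O.
    replace (truncation 0 u) with (fun n => u 0%nat * delta 0 n)%C.
    + now rewrite (unitary_scal _ HT).
    + apply functional_extensionality; intros [|k]; unfold truncation, delta; simpl; ring.
  - rewrite csum_S, <- IH.
    replace (truncation (S N) u)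
      with (fun n => 1 * truncation N u n + u (S N) * delta (S N) n)%C.
    + rewrite unitary_lin by (auto; apply in_l2_truncation); ring.
    + apply functional_extensionality; intros k; unfold truncation, delta.
      destruct (Nat.leb_spec k N), (Nat.leb_spec k (S N)), (Nat.eqb_spec k (S N));
        subst; try lia; ring.
Qed.

Lemma truncation_error (u : cseq) : in_l2 u ->
  (forall N, in_l2 (fun n => u n - truncation N u n)%C) /\
  is_lim_seq (fun N => l2_norm (fun n => u n - truncation N u n)%C) 0.
Proof.
  intros Hu; set (a := fun n => Cmod (u n) ^ 2).
  assert (Hs : forall N, is_series (fun n => Cmod (u n - truncation N u n) ^ 2)
    (Series a - sum_n a N)).
  { intros N; set (d := fun n => Cmod (u n - truncation N u n) ^ 2).
    apply (is_lim_seq_ext_loc (fun n => sum_n a n - sum_n a N) (sum_n d) (Series a - sum_n a N)).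
    - exists N; intros n Hn; induction Hn as [|n Hn IH].
      + rewrite Rminus_diag_eq by reflexivity; symmetry.
        rewrite (sum_n_ext_loc _ (fun _ => 0)); [now rewrite sum_n_const, Rmult_0_r|].
        intros k Hk; unfold d, truncation; rewrite (proj2 (Nat.leb_le k N) Hk).
        replace (u k - u k)%C with (RtoC 0) by ring; rewrite Cmod_0; simpl; ring.
      + rewrite !sum_Sn, <- IH; unfold plus; simpl.
        replace (d (S n)) with (a (S n)); [ring|].
        unfold a, d, truncation; rewrite (proj2 (Nat.leb_gt (S n) N)) by lia.
        do 2 f_equal; ring.
    - apply is_lim_seq_minus'; [|apply is_lim_seq_const].
      apply (Series_correct _ Hu). }
  split; [intros N; eexists; apply Hs|].
  apply is_lim_seq_ext with (fun N => sqrt (Series a - sum_n a N)).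
  { intros N; unfold l2_norm; f_equal; symmetry; apply is_series_unique, Hs. }
  rewrite <- sqrt_0; apply is_lim_seq_continuous; [apply continuity_pt_sqrt, Rle_refl|].
  replace 0 with (Series a - Series a) by ring.
  apply is_lim_seq_minus'; [apply is_lim_seq_const | apply (Series_correct _ Hu)].
Qed.

(** With [a n = w n |u n|] one has |u n| <= a n <= Series a, hence |u n|^2 <= Series a * a n. *)
Lemma in_l1_in_l2 (w : nat -> R) (u : cseq) :
  (forall n, 1 <= w n) -> in_l1 w u -> in_l2 u.
Proof.
  intros Hw Hu; set (a := fun n => w n * Cmod (u n)).
  assert (Hle : forall n, Cmod (u n) <= a n).
  { intros n; unfold a; pose proof (Cmod_ge_0 (u n)); specialize (Hw n); nra. }
  assert (Ha : forall n, 0 <= a n).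
  { intros n; pose proof (Cmod_ge_0 (u n)); specialize (Hle n); lra. }
  apply (ex_series_le (V := R_CompleteNormedModule) _ (fun n => Series a * a n)).
  - intros n; change (@norm _ _ ?x) with (Rabs x).
    rewrite Rabs_right by (apply Rle_ge, pow2_ge_0).
    assert (a n <= Series a).
    { eapply Rle_trans; [apply (term_le_sum_n a n n Ha), le_n | now apply sum_n_le_Series]. }
    pose proof (Cmod_ge_0 (u n)); specialize (Hle n); specialize (Ha n); simpl; nra.
  - now apply (ex_series_scal (V := R_NormedModule) (Series a) a).
Qed.

(** Linearity gives the estimate for truncations only. Unitarity then controls each component of the
    image of the tail by the l2 norm of the tail, which tends to 0. *)
Lemma l1_linf_bound (T : cseq -> cseq) (w : nat -> R) (r : R) :
  unitary T -> 0 <= r -> (forall n, 1 <= w n) ->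
  (forall m n, Cmod (T (delta m) n) <= r * (w m * w n)) ->
  forall u n, in_l1 w u -> / w n * Cmod (T u n) <= r * l1_norm w u.
Proof.
  intros HT Hr Hw Hmn u n Hu.
  assert (Hu2 := in_l1_in_l2 w u Hw Hu).
  destruct (truncation_error u Hu2) as [Herr Hlim].
  assert (Hwn := Hw n).
  assert (Hn : 0 < / w n) by (apply Rinv_0_lt_compat; lra).
  assert (H : Rbar_le (Cmod (T u n)) (r * w n * l1_norm w u + 0)).
  { apply (is_lim_seq_le (fun _ => Cmod (T u n))
      (fun N => r * w n * l1_norm w u + l2_norm (fun n => u n - truncation N u n)%C));
      [|apply is_lim_seq_const | apply is_lim_seq_plus'; [apply is_lim_seq_const | exact Hlim]].
    intros N.
    replace (T u) with (fun n => 1 * T (truncation N u) n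
      + 1 * T (fun n => u n - truncation N u n)%C n)%C.
    2:{ rewrite <- unitary_lin by (auto; apply in_l2_truncation).
        f_equal; apply functional_extensionality; intros; ring. }
    cbv beta; rewrite !Cmult_1_l; eapply Rle_trans; [apply Cmod_triangle|].
    apply Rplus_le_compat.
    - rewrite unitary_truncation by exact HT.
      eapply Rle_trans; [apply (Cmod_csum _ (fun m => r * w n * (w m * Cmod (u m))))|].
      + intros m _; rewrite Cmod_mult; pose proof (Cmod_ge_0 (u m)); specialize (Hmn m n).
        replace (r * w n * (w m * Cmod (u m))) with (Cmod (u m) * (r * (w m * w n))) by ring.
        now apply Rmult_le_compat_l.
      + rewrite (sum_n_mult_l (K := R_Ring)).
        apply Rmult_le_compat_l; [apply Rmult_le_pos; lra|].
        apply sum_n_le_Series; [|exact Hu].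
        intros m; apply Rmult_le_pos; [specialize (Hw m); lra | apply Cmod_ge_0].
    - rewrite <- (unitary_norm _ HT) by apply Herr.
      apply (Cmod_le_l2_norm (T (fun n => u n - truncation N u n)%C)).
      apply (unitary_l2 _ HT), Herr. }
  simpl in H; rewrite Rplus_0_r in H.
  apply (Rmult_le_reg_l (w n)); [lra|].
  rewrite <- Rmult_assoc, Rinv_r, Rmult_1_l by lra; lra.
Qed.

Lemma Sup_seq_le (v : nat -> Rbar) (B : R) :
  (forall n, Rbar_le (v n) B) -> Rbar_le (Sup_seq v) B.
Proof.
  intros H; assert (Hs := Sup_seq_correct v); destruct (Sup_seq v) as [l| |]; simpl in *.
  - apply Rnot_lt_le; intros Hl.
    destruct (Hs (mkposreal (l - B) ltac:(lra))) as [_ [n Hn]]; specialize (H n).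
    simpl in Hn; destruct (v n); simpl in *; try tauto; lra.
  - destruct (Hs B) as [n Hn]; specialize (H n).
    destruct (v n); simpl in *; try tauto; lra.
  - exact I.
Qed.

Theorem theorem6p5 (alpha : R) (halpha : 0 <= alpha)
    (U : R -> cseq -> cseq)
    (hU : is_unitary_group (H_dom alpha) (tau alpha) U) (t : R) :
  l1_linf_opnorm (sigma_seq alpha) (fun n => / sigma_seq alpha n) (U t)
  = Finite (Rpower (1 / (1 + t ^ 2)) ((1 + alpha) / 2)).
Proof.
  set (r := Rpower (1 / (1 + t ^ 2)) ((1 + alpha) / 2)).
  assert (Hr : 0 < r) by apply exp_pos.
  apply is_glb_Rbar_unique; split.
  (* Lower bound: [delta 0] has weighted norm 1, and component 0 of its image is the amplitude. *)
  - intros c [_ Hc]; simpl.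
    assert (Hd : is_series (fun n => sigma_seq alpha n * Cmod (delta 0 n)) 1).
    { assert (H := is_series_finite (fun n => sigma_seq alpha n * Cmod (delta 0 n)) 0).
      rewrite sum_O, delta_eq, sigma_0, Cmod_1, Rmult_1_r in H by assumption; apply H.
      intros n Hn; rewrite delta_neq, Cmod_0 by lia; ring. }
    assert (Hc0 := Hc (delta 0) (ex_intro _ 1 Hd)).
    unfold l1_norm in Hc0; rewrite (is_series_unique _ _ Hd), Rmult_1_r in Hc0.
    apply (Rbar_le_trans r _ c) with (2 := Hc0).
    apply (Sup_seq_minor_le _ _ 0%nat).
    rewrite (vacuum_orbit alpha U halpha hU); unfold coherent.
    rewrite sigma_0, !Cmod_mult, Cmod_amplitude, Cmod_R, Cmod_pow, pow_O, Rabs_R1 by assumption.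
    fold r; simpl; lra.
  (* Upper bound: [r] itself is an admissible constant, by the matrix element estimate. *)
  - intros c Hc; apply Hc; split; [lra|]; intros u Hu.
    apply Sup_seq_le; intros n; simpl.
    apply l1_linf_bound; [apply (group_unitary _ _ _ hU) | lra | | | exact Hu].
    + now apply sigma_ge_1.
    + intros m k; now apply matrix_element_bound.
Qed.
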